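(* Let $d\ge 3$, $e\ge 1$, $N\ge 2$ and let $\mathcal{L}=\{\mathcal{T}_1,\ldots,\mathcal{T}_e\}$, with $\mathcal{T}_i=(\Pi_i,P_i,C_i)\in\mathcal{P}_d$ and $P_i\notin\Pi_j$ for $i\ne j$, be suited for degree $d$. (i) One has $\dim(\mathbb{P}_d(\mathcal{L}))=\binom{d-e+N}{N}$, where $\binom{d-e+N}{N}$ is interpreted as $0$ if $e>d$. If $e\le d$, a general element $X$ of $\mathbb{P}_d(\mathcal{L})$ is a smooth hypersurface of degree $d$. (ii) Let $\Pi$ be a hyperplane in $\mathbb{P}^N$ with $P_i\notin\Pi$ for $1\le i\le e$, and let $\Pi'_i=\Pi\cap\Pi_i$ for $1\le i\le e$. If $e\le d$, then $\mathbb{P}_{\Pi,d}(\mathcal{L})$ has dimension $\binom{d-e+N-1}{N-1}$ and it contains $\Pi'_1+\cdots+\Pi'_e+\mathbb{P}_{\Pi,d-e}$. If $e>d$, then $\mathbb{P}_{\Pi,d}(\mathcal{L})$ has dimension $0$. (iii) Let $\Pi$ be a hyperplane with $P_i\notin\Pi$ for $1\le i\le e$. Fix a point $P\in\Pi$ with $P\notin\Pi_i$ for $1\le i\le e$, and a good $P$-cone $C$ of degree $d$ in $\Pi$. Let $\mathcal{T}=(\Pi,P,C)$ and $\mathcal{L}'=\mathcal{L}\cup\{\mathcal{T}\}$. Then $\mathcal{L}'$ is suited for degree $d$ if and only if $C\in\mathbb{P}_{\Pi,d}(\mathcal{L})$.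
   Context: The base field is $\mathbb{C}$. A hypersurface $C$ of degree $d$ (an effective divisor) in a projective space $\Pi$ is a good $P$-cone of degree $d$ if it is a cone with vertex $P$ (i.e. it has multiplicity $d$ at $P$) and it is smooth outside $P$. $\mathcal{P}_d$ is the space of triples $(\Pi,P,C)$ with $\Pi$ a hyperplane in $\mathbb{P}^N$, $P$ a point of $\Pi$ and $C$ a good $P$-cone of degree $d$ in $\Pi$. For triples $\mathcal{T}_i=(\Pi_i,P_i,C_i)\in\mathcal{P}_d$, $1\le i\le e$, with $P_i\notin\Pi_j$ for $i\neq j$, the set $\mathcal{L}=\{\mathcal{T}_1,\dots,\mathcal{T}_e\}$ is suited for degree $d$ if there exists a hypersurface $X$ of degree $d$ in $\mathbb{P}^N$ such that, for every $1\le i\le e$, $X$ does not contain $\Pi_i$ and $X\cap\Pi_i=C_i$ as schemes. $V_d(\mathcal{L})=\{s\in\Gamma(\mathbb{P}^N,\mathcal{O}_{\mathbb{P}^N}(d)) : C_i\subset Z(s)\text{ for }1\le i\le e\}$, where $Z(s)$ is the zero scheme of $s$, and $\mathbb{P}_d(\mathcal{L})=\mathbb{P}(V_d(\mathcal{L}))$ is the corresponding linear system of hypersurfaces of degree $d$. For a hyperplane $\Pi$, $V_{\Pi,d}(\mathcal{L})$ is the image of the restriction map $V_d(\mathcal{L})\to\Gamma(\Pi,\mathcal{O}_\Pi(d))$, and $\mathbb{P}_{\Pi,d}(\mathcal{L})=\mathbb{P}(V_{\Pi,d}(\mathcal{L}))$. $\mathbb{P}_{\Pi,k}$ denotes the complete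 linear system of all effective divisors of degree $k$ on $\Pi$. Dimensions of linear systems are projective dimensions. *)

(* Defs.v *)
From HB Require Import structures.
From mathcomp Require Import all_boot all_order all_algebra.
From mathcomp Require Import mpoly.

Set Implicit Arguments.
Unset Strict Implicit.
Unset Printing Implicit Defensive.

Import GRing.Theory.
Local Open Scope ring_scope.

(* Conventions.  The ambient projective space is P^N with N = n.+1.
   - A point of P^k is (represented by) a nonzero row vector 'rV_k.+1; two
     nonzero rows are the same point iff they span the same line, so that
     q = p in P^k is (q <= p)%MS.
   - A hyperplane H of P^N is the projectivization of a subspace of dimension N
     of F^(N+1), represented as the row space of a row-free H : 'M_(N, N.+1).
     The rows of H provide homogeneous coordinates on H: the row y : 'rV_N
     stands for the point y *m H.  In these coordinates Gamma(H, O_H(d)) is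
     dhomog N F d.  Every notion below is independent of the choice of the
     basis H of the subspace.
   - Hypersurfaces (effective divisors) of degree d are nonzero forms of
     degree d, up to a scalar. *)

Section Hypersurfaces.
Variables (F : closedFieldType) (m : nat).
Implicit Types (f g : {mpoly F[m]}) (p q : 'rV[F]_m).

(* The inclusion Z(f) \subset Z(g) of zero schemes, i.e. the inclusion of
   homogeneous ideals (g) \subset (f); principal homogeneous ideals are
   saturated as soon as there are at least two variables. *)
Definition zero_scheme_sub f g := exists h : {mpoly F[m]}, g = h * f.

Definition zero_scheme_eq f g := zero_scheme_sub f g /\ zero_scheme_sub g f.

(* f(p + X) *)
Definition translate f p : {mpoly F[m]} :=
  f \mPo [tuple 'X_i + (p ord0 i)%:MP | i < m].

(* Z(f) has multiplicity k at p: k is the least degree of a monomial of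
   f(p + X).  For f homogeneous and p nonzero, the order of f at p in affine
   space is the order at the point p of a local equation of Z(f). *)
Definition has_multiplicity f p (k : nat) :=
  (forall u, u \in msupp (translate f p) -> (k <= mdeg u)%N) /\
  (exists2 u, u \in msupp (translate f p) & mdeg u = k).

(* Jacobian criterion, at a point q of Z(f) *)
Definition smooth_at f q := exists i : 'I_m, (f^`M(i)).@[q ord0] != 0.

Definition smooth_hypersurface f :=
  f != 0 /\ (forall q, q != 0 -> f.@[q ord0] = 0 -> smooth_at f q).

Definition good_cone (d : nat) (C : dhomog m F d) p :=
  [/\ C != 0, has_multiplicity C p d
    & forall q, q != 0 -> ~~ (q <= p)%MS -> (mpoly_of_dhomog C).@[q ord0] = 0 -> smooth_at C q].

End Hypersurfaces.

Section LinearSystems.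
Variables (F : closedFieldType) (E : vectType F).

Definition subspace_of (W : E -> Prop) (V : {vspace E}) :=
  forall s, s \in V <-> W s.

(* W is a linear subspace and the linear system P(W) has dimension k *)
Definition proj_dim (W : E -> Prop) (k : nat) :=
  exists2 V, subspace_of W V & \dim V = k.+1.

(* U defines a Zariski open subset of P(V): the complement of the common zero
   locus of a set Z of homogeneous polynomials in the coordinates of V.  The
   values of U outside of V \ {0} are irrelevant. *)
Definition zariski_open (V : {vspace E}) (U : E -> Prop) :=
  exists Z : {mpoly F[\dim V]} -> Prop,
    (forall G, Z G -> exists k, G \is k.-homog) /\
    (forall s, s \in V -> s != 0 ->
      (U s <-> exists2 G, Z G & G.@[fun i => coord (vbasis V) i s] != 0)).

(* A general element of P(W) satisfies Q: Q holds on a nonempty Zariski open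
   subset of P(W). *)
Definition general (W Q : E -> Prop) :=
  exists2 V, subspace_of W V &
  exists U, [/\ zariski_open V U,
    exists s, [/\ s \in V, s != 0 & U s] &
    forall s, s \in V -> s != 0 -> U s -> Q s].

End LinearSystems.

Section Cones.
Variables (F : closedFieldType) (n d : nat).

Definition restriction (H : 'M[F]_(n.+1, n.+2)) (f : {mpoly F[n.+2]}) :
    {mpoly F[n.+1]} :=
  f \mPo [tuple \sum_(i < n.+1) H i j *: 'X_i | j < n.+2].

Record triple := Triple {
  hplane : 'M[F]_(n.+1, n.+2);
  vertex : 'rV[F]_n.+2;
  cone : dhomog n.+1 F d
}.

(* The space P_d; vertex T *m pinvmx (hplane T) is the row of coordinates of
   the vertex in the hyperplane. *)
Definition in_Pd (T : triple) :=
  [/\ row_free (hplane T), vertex T != 0, (vertex T <= hplane T)%MS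
    & good_cone (cone T) (vertex T *m pinvmx (hplane T))].

Section Families.
Variables (I : Type) (L : I -> triple).

Definition suited :=
  exists2 X : dhomog n.+2 F d, X != 0 &
  forall i, restriction (hplane (L i)) X != 0 /\
            zero_scheme_eq (restriction (hplane (L i)) X) (cone (L i)).

(* C_i \subset Z(s) is tested on the zero scheme of s in the hyperplane. *)
Definition Vd (s : dhomog n.+2 F d) :=
  forall i, zero_scheme_sub (cone (L i)) (restriction (hplane (L i)) s).

Definition Vd_restricted (H : 'M[F]_(n.+1, n.+2)) (f : {mpoly F[n.+1]}) :=
  exists2 s : dhomog n.+2 F d, Vd s & f = restriction H s.

End Families.

(* h is the equation, in the coordinates of H, of the hyperplane
   H \cap H' of H *)
Definition section_equation (H H' : 'M[F]_(n.+1, n.+2)) (h : dhomog n.+1 F 1) :=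
  forall y : 'rV[F]_n.+1, (mpoly_of_dhomog h).@[y ord0] = 0 <-> (y *m H <= H')%MS.

End Cones.

(* Main.v *)
From HB Require Import structures.
Require Import Defs.
From mathcomp Require Import all_boot all_order all_algebra.
From mathcomp Require Import boolp classical_sets reals complex mpoly closed_field.
From mathcomp Require Import lra.

Set Implicit Arguments.
Unset Strict Implicit.
Unset Printing Implicit Defensive.

Import Order.TTheory GRing.Theory Num.Theory.
Local Open Scope ring_scope.

(** Choose a linear equation of each hyperplane Pi_i, let l be the product of
these e equations, and let X be a hypersurface that witnesses that the family
is suited.

The linear algebra rests on one remark: a cone with vertex P in a projective
space contains no hyperplane that misses P, because it is invariant under
translations along P ([cone_section_nonzero]).  A form s in V_d restricts to a
multiple a_i X on each Pi_i.  On Pi_i /\ Pi_j the form X is not identically 0,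
so that a_i = a_j; hence s - aX vanishes on all Pi_i and is divisible by l
([restriction_eq0_dvd], [product_dvd]).  So V_d is the direct sum of the line
spanned by X and of l times the forms of degree d - e, which are 0 if e > d
([Vd_decomposition]).  Restriction to a further hyperplane Pi that misses the
vertices preserves this description, again because X does not vanish on
Pi /\ Pi_i ([restrictedP_le]).  If such a restriction is the cone of a new
triple, the coefficient of X is nonzero, since l vanishes on Pi /\ Pi_i and the
cone does not; the form then cuts out all the cones ([suited_extension]).

The smoothness of a general member is a case of the theorem of Bertini, in
characteristic 0.  Its heart is an elimination statement.  Let P(w, x) be a
polynomial with integer coefficients which vanishes at a point together with
its derivatives in the variables x.  If the derivative of P at that point, in
some direction of the space of the variables w, is not 0, then some polynomial
Q(w) without x has the same two properties ([eliminate_variables]).  Apply this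
to the universal form P(w, x) = sum of w_a x^a, at a singular point q of a
member sum t_i b_i of a linear system, in the direction of the coefficients of
b_i: the derivative is b_i(q).  If b_i(q) were not 0, the vector t would be a
zero of a polynomial Q(sum t_i b_i) that is not identically 0.  There are only
countably many Q and the field is uncountable, so that some t avoids them all:
for this t the singularities lie in the base locus
([generic_singularity_in_base_locus]).  The base locus of V_d is the union of
the cones C_i.  There a member with a nonzero coefficient at X is smooth
outside of P_i, because its section by Pi_i is C_i, and a generic one is smooth
at P_i since a product l g has a nonzero differential there
([smooth_at_base_point]).

So one member is smooth, and it can be chosen to avoid any given hypersurface
of the parameter space.  By elimination of quantifiers over an algebraically
closed field, either the smooth or the singular members contain a nonempty
Zariski open set of parameters ([generically_decided_holds]); the second case
is thus excluded.  Homogeneous components of the equation of the complement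
give the open set required of a general element ([general_of_generic]). *)

(** * Polynomials in several variables *)

Section MpolyGeneralities.
Variable R : comNzRingType.

(** The form in which identities between ring morphisms and derivations are
checked: on constants and on variables. *)
Lemma mpoly_alg_ind (n : nat) (P : {mpoly R[n]} -> Prop) :
    (forall c, P c%:MP) -> (forall i, P 'X_i) ->
    (forall p q, P p -> P q -> P (p + q)) ->
    (forall p q, P p -> P q -> P (p * q)) ->
  forall p, P p.
Proof.
move=> PC PX PD PM p.
have P0 : P 0 by rewrite -(mpolyC0 n).
elim/mpolyind: p => // c m p _ _ Pp.
apply/PD => //; rewrite -mul_mpolyC; apply/PM => //.
rewrite mpolyXE_id.
have P1 : P 1 by rewrite -(mpolyC1 n).
elim/big_rec: _ => // i x _ Px; apply/PM => //.
elim: (m i) => [|k IHk]; first by rewrite expr0.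
by rewrite exprS; apply/PM.
Qed.

Local Notation widen := (widen_ord (leqnSn _)).

Lemma muniX (n : nat) (m : 'X_{1..n.+1}) :
  muni 'X_[R, m] = 'X_[[multinom m (widen i) | i < n]] *: 'X^(m ord_max).
Proof.
rewrite muniE msuppX big_seq1 mcoeffX eqxx scale1r //.
Qed.

Lemma muniXmax (n : nat) : muni ('X_ord_max : {mpoly R[n.+1]}) = 'X.
Proof.
rewrite muniX mnm1E eqxx expr1.
rewrite (_ : [multinom _ | _ < _] = 0%MM) ?mpolyX0 ?scale1r //.
apply/mnmP=> i; rewrite mnmE mnm1E mnm0E.
by rewrite -val_eqE /= gtn_eqF.
Qed.

Lemma muniXwiden (n : nat) (i : 'I_n) :
  muni ('X_(widen i) : {mpoly R[n.+1]}) = ('X_i)%:P.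
Proof.
rewrite muniX mnm1E -val_eqE /= ltn_eqF // expr0.
rewrite (_ : [multinom _ | _ < _] = U_(i)%MM) ?alg_polyC //.
by apply/mnmP=> j; rewrite mnmE !mnm1E.
Qed.

Lemma ord_widenP (n : nat) (i : 'I_n.+1) :
  i = ord_max \/ exists j : 'I_n, i = widen j.
Proof.
case: (unliftP ord_max i) => [j ->|->]; [right | by left].
by exists j; apply: val_inj; rewrite /= /bump leqNgt ltn_ord.
Qed.

(** Substituting the last variable back is a left inverse of [muni]. *)
Lemma muni_inj (n : nat) : injective (@muni n R).
Proof.
pose phi (q : {poly {mpoly R[n]}}) : {mpoly R[n.+1]} :=
  (map_poly (@mwiden n R) q).['X_ord_max].
have phiD a b : phi (a + b) = phi a + phi b.
  by rewrite /phi [map_poly _ (a + b)]raddfD hornerD.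
have phiM a b : phi (a * b) = phi a * phi b.
  by rewrite /phi [map_poly _ (a * b)]rmorphM hornerM.
have phiC c : phi c%:P = mwiden c by rewrite /phi map_polyC hornerC.
have phiX : phi 'X = 'X_ord_max by rewrite /phi map_polyX hornerX.
have phiK p : phi (muni p) = p.
  clearbody phi.
  elim/mpoly_alg_ind: p => [c|i|p q IHp IHq|p q IHp IHq].
  - by rewrite muniC phiC mwidenC.
  - case: (ord_widenP i) => [->|[j ->]].
      by rewrite muniXmax phiX.
    by rewrite muniXwiden phiC mwidenX mnmwiden1.
  - by rewrite muniD phiD; congr (_ + _).
  - by rewrite muniM phiM; congr (_ * _).
exact: can_inj phiK.
Qed.

Lemma mderivXU (n : nat) (i j : 'I_n) :
  ('X_i : {mpoly R[n]})^`M(j) = ((i == j)%:R)%:MP.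
Proof.
rewrite mderivX mnm1E; case: eqP => [->|_]; last by rewrite scale0r.
by rewrite scale1r -{1}[U_(j)%MM]add0m addmK mpolyX0.
Qed.

Lemma muni_mderiv_max (n : nat) (p : {mpoly R[n.+1]}) :
  muni p^`M(ord_max) = (muni p)^`().
Proof.
elim/mpoly_alg_ind: p => [c|i|p q IHp IHq|p q IHp IHq].
- by rewrite mderivC muni0 muniC derivC.
- rewrite mderivXU muniC; case: (ord_widenP i) => [->|[j ->]].
    by rewrite muniXmax derivX eqxx.
  by rewrite muniXwiden derivC -val_eqE /= ltn_eqF.
- rewrite mderivD 2!muniD derivD; exact: (congr2 +%R IHp IHq).
- rewrite mderivM muniD 3!muniM derivM.
  by congr (_ * _ + _ * _); [apply: IHp | apply: IHq].
Qed.

(** [D] is a derivation along the morphism [f]; it extends to polynomials with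
the variable as a constant. *)
Lemma map_poly_leibniz (A B : comNzRingType) (f : {rmorphism A -> B})
    (D : A -> B) (p q : {poly A}) :
    (forall a b, D (a + b) = D a + D b) ->
    (forall a b, D (a * b) = D a * f b + f a * D b) ->
  map_poly D (p * q) = map_poly D p * map_poly f q + map_poly f p * map_poly D q.
Proof.
move=> DD DM.
have D0 : D 0 = 0 by apply: (addrI (D 0)); rewrite -DD !addr0.
apply/polyP=> k; rewrite coefD !coefM coef_map_id0 // coefM.
have -> (I : Type) (r : seq I) (F : I -> A) : D (\sum_(i <- r) F i) = \sum_(i <- r) D (F i).
  exact: big_morph.
rewrite -big_split /=; apply: eq_bigr => i _.
by rewrite !coef_map_id0 ?rmorph0.
Qed.

Lemma map_poly_derivation (A : comNzRingType) (D : A -> A) (p q : {poly A}) :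
    (forall a b, D (a + b) = D a + D b) ->
    (forall a b, D (a * b) = D a * b + a * D b) ->
  map_poly D (p * q) = map_poly D p * q + p * map_poly D q.
Proof.
move=> DD DM; rewrite (@map_poly_leibniz _ _ idfun) //.
by rewrite [map_poly idfun q]map_poly_id // [map_poly idfun p]map_poly_id.
Qed.

Lemma muni_mderiv_widen (n : nat) (i : 'I_n) (p : {mpoly R[n.+1]}) :
  muni p^`M(widen i) = map_poly (mderiv i) (muni p).
Proof.
elim/mpoly_alg_ind: p => [c|j|p q IHp IHq|p q IHp IHq].
- by rewrite mderivC muni0 muniC map_polyC /= mderivC.
- rewrite mderivXU muniC; case: (ord_widenP j) => [->|[k ->]].
    rewrite muniXmax -val_eqE /= gtn_eqF // mpolyC0 polyC0.
    apply/polyP=> l; rewrite coef0 coef_map_id0 ?mderiv0 // coefX -(mpolyC_nat n).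
    by rewrite mderivC.
  by rewrite muniXwiden map_polyC /= mderivXU.
- rewrite mderivD 2!muniD raddfD /=; exact: (congr2 +%R IHp IHq).
- rewrite mderivM muniD 3!muniM.
  rewrite (map_poly_derivation _ _ (mderivD i) (mderivM i)).
  by congr (_ * _ + _ * _); [apply: IHp | apply: IHq].
Qed.

End MpolyGeneralities.

Lemma mderiv_map_mpoly (A B : comNzRingType) (f : {rmorphism A -> B}) (k : nat)
    (i : 'I_k) (p : {mpoly A[k]}) :
  (map_mpoly f p)^`M(i) = map_mpoly f p^`M(i).
Proof.
apply/mpolyP => m; rewrite mcoeff_deriv !mcoeff_map_mpoly mcoeff_deriv.
by rewrite raddfMn.
Qed.

Section Homogeneous.
Variables (F : idomainType) (k : nat).
Implicit Types (p q : {mpoly F[k]}).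

Lemma meval_homogZ (d : nat) p (a : F) (v : 'I_k -> F) : p \is d.-homog ->
  p.@[fun i => a * v i] = a ^+ d * p.@[v].
Proof.
move=> /dhomogP hp; rewrite !mevalE big_distrr /=; apply: eq_big_seq => m mp.
rewrite mulrCA; congr (_ * _); have <- : mdeg m = d := hp m mp.
rewrite mdegE -prodrXr -big_split /=.
by apply: eq_bigr => i _; rewrite exprMn.
Qed.

Lemma pihomogM_homog (d l : nat) p q : p \is d.-homog ->
  pihomog mdeg (d + l) (p * q) = p * pihomog mdeg l q.
Proof.
move=> hp; pose s := (maxn l.+1 (msize q)).
have sq : (mmeasure mdeg q <= s)%N by apply: leq_maxr.
have ls : (l < s)%N by apply: leq_maxl.
rewrite {1}(pihomog_partitionE sq) big_distrr raddf_sum /=.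
rewrite (bigD1 (Ordinal ls)) //= big1 ?addr0.
  by rewrite pihomog_dE // dhomogM // pihomogP.
move=> i il; apply: (@pihomog_ne0 _ _ _ (d + i)); last by rewrite dhomogM // pihomogP.
by rewrite eqn_add2l.
Qed.

(** Multiplication by a homogeneous polynomial shifts homogeneous components. *)
Lemma homog_cofactor (d l : nat) p q : p != 0 ->
  p \is d.-homog -> p * q \is (d + l).-homog -> q \is l.-homog.
Proof.
move=> p0 hp /pihomog_dE hpq.
rewrite homog_piE; apply/eqP/(mulfI p0).
by rewrite -(pihomogM_homog _ _ hp).
Qed.

Lemma homog_cofactor_lt (d l : nat) p q : (l < d)%N ->
  p \is d.-homog -> p * q \is l.-homog -> p * q = 0.
Proof.
move=> ld hp hpq; have [->|p0] := eqVneq p 0; first by rewrite mul0r.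
have [->|q0] := eqVneq q 0; first by rewrite mulr0.
pose s := msize q; have sq : (mmeasure mdeg q <= s)%N by [].
have := pihomog_dE hpq.
rewrite {1}(pihomog_partitionE sq) big_distrr raddf_sum /= => <-.
apply: big1 => i _; apply: (@pihomog_ne0 _ _ _ (d + i)).
  by rewrite gtn_eqF // ltn_addr.
by rewrite dhomogM // pihomogP.
Qed.

Lemma homog0_const p : p \is 0.-homog -> exists c, p = c%:MP.
Proof.
move=> /dhomogP hp; exists p@_0; apply: msize1_polyC.
rewrite msizeE; apply/bigmax_leqP_seq => m mp _.
by have := hp m mp => /= ->.
Qed.

Lemma homog_same_degree (d : nat) p q : p != 0 ->
  p \is d.-homog -> q * p \is d.-homog -> exists c, q = c%:MP.
Proof.
move=> p0 hp hqp; apply: homog0_const.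
by apply: (homog_cofactor p0 hp); rewrite addn0 mulrC.
Qed.

Lemma homog_prod_const (I : finType) (d : I -> nat) (p : I -> {mpoly F[k]}) :
  (forall i, p i \is (d i).-homog) -> \prod_i p i \is (\sum_i d i).-homog.
Proof.
move=> hp; elim/big_rec2: _ => [|i e q _ hq]; first exact: dhomog1.
exact: dhomogM.
Qed.

End Homogeneous.

Lemma mderiv_homog (R : comNzRingType) (k d : nat) (f : {mpoly R[k]}) (i : 'I_k) :
  f \is d.-homog -> f^`M(i) \is d.-1.-homog.
Proof.
move=> /dhomogP hf; apply/dhomogP => m; rewrite mcoeff_msupp mcoeff_deriv => fm.
have /hf /= <- : (m + U_(i))%MM \in msupp f.
  by rewrite mcoeff_msupp; apply: contraNneq fm => ->; rewrite mul0rn.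
by rewrite mdegD mdeg1 addn1.
Qed.

Section LinearForms.
Variables (F : fieldType) (k : nat).

Definition linear_form (c : 'cV[F]_k) : {mpoly F[k]} := \sum_i c i 0 *: 'X_i.

Lemma linear_form_homog c : linear_form c \is 1.-homog.
Proof.
apply: rpred_sum => i _; apply: rpredZ; rewrite dhomogX.
by rewrite /= mdeg1.
Qed.

Lemma meval_linear_form c (v : 'rV[F]_k) : (linear_form c).@[v ord0] = (v *m c) 0 0.
Proof.
rewrite /linear_form raddf_sum /= mxE; apply: eq_bigr => i _.
by rewrite mevalZ mevalXU mulrC.
Qed.

Lemma mderiv_linear_form c i : (linear_form c)^`M(i) = (c i 0)%:MP.
Proof.
rewrite /linear_form raddf_sum /= (bigD1 i) //= mderivZ mderivXU eqxx.
rewrite big1 ?addr0 => [|j ji]; first by rewrite -mul_mpolyC mulr1.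
by rewrite mderivZ mderivXU (negbTE ji) mpolyC0 scaler0.
Qed.

Lemma homog1_linear_form (p : {mpoly F[k]}) : p \is 1.-homog ->
  p = linear_form (\col_i p@_U_(i)).
Proof.
move=> /dhomogP hp; apply/mpolyP => m; rewrite /linear_form raddf_sum /=.
under eq_bigr => i _ do rewrite mcoeffZ mcoeffX mxE.
have [/eqP|m1] := eqVneq (mdeg m) 1%N.
  rewrite mdeg_eq1 => /existsP[i /eqP ->].
  rewrite (bigD1 i) //= eqxx mulr1 big1 ?addr0 // => j ji.
  by rewrite eq_mnm1 (negbTE ji) mulr0.
rewrite big1 => [|i _].
  by apply: memN_msupp_eq0; apply: contra m1 => /hp /= ->.
by case: eqP => [e|_]; rewrite ?mulr0 //; rewrite -e mdeg1 eqxx in m1.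
Qed.

End LinearForms.

Section Substitution.
Variables (F : comNzRingType) (k m : nat).

(** Congruences modulo [l] are stable under sums and products. *)
Lemma comp_mpoly_congr (p q a : m.-tuple {mpoly F[k]}) (l : {mpoly F[k]}) (f : {mpoly F[m]}) :
    (forall i, tnth p i = tnth q i + l * tnth a i) ->
  exists g, f \mPo p = f \mPo q + l * g.
Proof.
move=> pq; elim/mpoly_alg_ind: f => [c|i|f f' [g fE] [g' f'E]|f f' [g fE] [g' f'E]].
- by exists 0; rewrite !comp_mpolyC mulr0 addr0.
- by exists (tnth a i); rewrite !comp_mpolyXU -!tnth_nth pq.
- by exists (g + g'); rewrite 2!comp_mpolyD fE f'E mulrDr addrACA.
exists (g * (f' \mPo q) + (f \mPo q) * g' + l * (g * g')).
rewrite 2![_ \mPo _]rmorphM /= fE f'E mulrDl !mulrDr -!addrA; congr (_ + _).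
rewrite mulrCA [X in _ = X]addrCA; congr (_ + _).
by rewrite !mulrA [l * g * l]mulrAC.
Qed.

Lemma comp_mpoly_homog (p : m.-tuple {mpoly F[k]}) (d : nat) (f : {mpoly F[m]}) :
  (forall i, tnth p i \is 1.-homog) -> f \is d.-homog -> f \mPo p \is d.-homog.
Proof.
move=> hp /dhomogP hf; rewrite comp_mpolyEX big_seq; apply: rpred_sum => u uf.
apply: rpredZ; have <- : mdeg u = d := hf u uf.
rewrite comp_mpolyX mdegE.
elim/big_rec2: _ => [|i e q _ hq]; first exact: dhomog1.
by apply: dhomogM => //; have := dhomogMn (u i) (hp i); rewrite mul1n.
Qed.

Definition linear_subst (M : 'M[F]_(k, m)) (f : {mpoly F[m]}) : {mpoly F[k]} :=
  f \mPo [tuple \sum_(i < k) M i j *: 'X_i | j < m].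

Lemma meval_linear_subst M f (v : 'rV[F]_k) :
  (linear_subst M f).@[v ord0] = f.@[(v *m M) ord0].
Proof.
rewrite comp_mpoly_meval; apply: meval_eq => j.
rewrite tnth_mktuple raddf_sum mxE; apply: eq_bigr => l _.
by rewrite /= mevalZ mevalXU mulrC.
Qed.

Lemma linear_substD M f g : linear_subst M (f + g) = linear_subst M f + linear_subst M g.
Proof. exact: comp_mpolyD. Qed.

Lemma linear_substB M f g : linear_subst M (f - g) = linear_subst M f - linear_subst M g.
Proof. exact: comp_mpolyB. Qed.

Lemma linear_substZ M c f : linear_subst M (c *: f) = c *: linear_subst M f.
Proof. exact: comp_mpolyZ. Qed.

Lemma linear_substM M f g : linear_subst M (f * g) = linear_subst M f * linear_subst M g.
Proof. exact: rmorphM. Qed.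

Lemma linear_subst_prod M (I : Type) (r : seq I) (f : I -> {mpoly F[m]}) :
  linear_subst M (\prod_(i <- r) f i) = \prod_(i <- r) linear_subst M (f i).
Proof. exact: rmorph_prod. Qed.

Lemma linear_subst_homog M (d : nat) f : f \is d.-homog -> linear_subst M f \is d.-homog.
Proof.
apply: comp_mpoly_homog => i; rewrite tnth_mktuple; apply: rpred_sum => j _.
by apply: rpredZ; rewrite dhomogX /= mdeg1.
Qed.

(** The chain rule. *)
Lemma mderiv_linear_subst M f (i : 'I_k) (v : 'rV[F]_k) :
  (linear_subst M f)^`M(i).@[v ord0] = \sum_j M i j * f^`M(j).@[(v *m M) ord0].
Proof.
rewrite /linear_subst; set T := [tuple _ | _ < _].
set w := (v *m M) ord0.
have Tw (g : {mpoly F[m]}) : (g \mPo T).@[v ord0] = g.@[w].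
  exact: meval_linear_subst.
elim/mpoly_alg_ind: f => [c|l|f f' IH IH'|f f' IH IH'].
- by rewrite comp_mpolyC mderivC meval0 big1 // => j _; rewrite mderivC meval0 mulr0.
- rewrite comp_mpolyXU -tnth_nth tnth_mktuple (big_morph _ (mderivD i) (mderiv0 _ i)) /=.
  rewrite (big_morph _ (mevalD (v ord0)) (meval0 (v ord0))).
  rewrite (bigD1 i) //= big1 => [|j ji]; last first.
    by rewrite mderivZ mderivXU (negbTE ji) mevalZ mevalC mulr0.
  rewrite (bigD1 l) //= [X in _ = _ + X]big1 => [|j jl]; last first.
    by rewrite mderivXU eq_sym (negbTE jl) mevalC mulr0.
  by rewrite mderivZ !mderivXU !eqxx mevalZ !mevalC.
- rewrite comp_mpolyD mderivD mevalD IH IH' -big_split; apply: eq_bigr => j _.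
  by rewrite mderivD mevalD mulrDr.
rewrite [_ \mPo _]rmorphM mderivM mevalD !mevalM IH IH' !Tw big_distrl big_distrr.
rewrite -big_split; apply: eq_bigr => j _ /=.
rewrite mderivM mevalD 2!mevalM mulrDr mulrA; congr (_ + _).
  by rewrite mulrA.
by rewrite mulrA [f.@[w] * M i j]mulrC.
Qed.

End Substitution.

(** * Points avoiding countably many hypersurfaces *)

(** With [I := unit] this says that [F] is infinite, with countable [I] it says
in effect that [F] is uncountable. *)
Definition avoids_roots (F : idomainType) (I : Type) :=
  forall p : I -> {poly F}, (forall i, p i != 0) ->
  exists z, forall i, (p i).[z] != 0.

Lemma meval_muni (R : comNzRingType) (n : nat) (v : 'I_n.+1 -> R) (P : {mpoly R[n.+1]}) :
  P.@[v] = (map_poly (meval (fun i => v (widen_ord (leqnSn n) i))) (muni P)).[v ord_max].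
Proof.
set w := fun i : 'I_n => _.
elim/mpoly_alg_ind: P => [c|i|p q IHp IHq|p q IHp IHq].
- by rewrite mevalC muniC map_polyC hornerC /= mevalC.
- rewrite mevalXU; case: (ord_widenP i) => [->|[j ->]].
    by rewrite muniXmax map_polyX hornerX.
  by rewrite muniXwiden map_polyC hornerC /= mevalXU.
- rewrite muniD [map_poly _ _]raddfD hornerD mevalD.
  exact: (congr2 +%R IHp IHq).
- rewrite muniM [map_poly _ _]rmorphM hornerM mevalM.
  exact: (congr2 *%R IHp IHq).
Qed.

(** Induction on the number of variables: avoid first the zeros of the leading
coefficients in the last variable, then finitely many values of that variable
for each polynomial. *)
Lemma avoid_zeros (F : idomainType) (I : Type) : avoids_roots F I ->
  forall n (P : I -> {mpoly F[n]}), (forall i, P i != 0) ->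
  exists v : 'I_n -> F, forall i, (P i).@[v] != 0.
Proof.
move=> avoidF; elim=> [|n IHn] P P0.
  exists (fun=> 0) => i; move: (P0 i).
  by rewrite -[P i]mpolyKC mevalC mpolyC_eq0.
have [|w wP] := IHn (fun i => lead_coef (muni (P i))).
  move=> i; rewrite lead_coef_eq0; apply: contra (P0 i) => /eqP P'0.
  by apply/eqP/muni_inj; rewrite P'0 muni0.
have [|z zP] := avoidF (fun i => map_poly (meval w) (muni (P i))).
  move=> i; apply: contraNneq (wP i) => /(congr1 (fun p : {poly F} => p`_(size (muni (P i))).-1)).
  by rewrite coef_map coef0 => <-.
exists (fun i => if unlift ord_max i is Some j then w j else z) => i.
rewrite meval_muni unlift_none; move: (zP i); congr (_.[_] != _).
apply: eq_map_poly => p; apply: meval_eq => j.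
rewrite (_ : widen_ord _ j = lift ord_max j) ?liftK //.
by apply: val_inj; rewrite /= /bump leqNgt ltn_ord.
Qed.

Lemma avoids_roots_uncountable (F : closedFieldType) :
    (forall f : nat -> F, exists z, forall n, z != f n) ->
  forall I : countType, avoids_roots F I.
Proof.
move=> uncF I p p0.
pose rts (q : {poly F}) := sval (closed_field_poly_normal q).
pose f k : F := if @unpickle (I * nat)%type k is Some (i, j) then (rts (p i))`_j else 0.
have [z zf] := uncF f; exists z => i; apply: contraT; rewrite negbK => pz0.
have : root (p i) z by [].
rewrite (svalP (closed_field_poly_normal (p i))) rootZ ?lead_coef_eq0 //.
rewrite root_prod_XsubC => /(nthP 0) [j _ zj].
by have := zf (pickle (i, j)); rewrite /f pickleK zj eqxx.
Qed.

Lemma avoids_roots_closed (F : closedFieldType) : avoids_roots F unit.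
Proof.
move=> p p0; have [z zp] := closed_nonrootP _ (p0 tt).
by exists z; case.
Qed.

(** Cantor's nested intervals: the n-th step moves to a subinterval whose closure
misses [f n]. *)
Lemma real_uncountable (R : realType) (f : nat -> R) : exists x, forall n, x != f n.
Proof.
pose step (c : R) (ab : R * R) : R * R :=
  let m := (ab.1 + ab.2) / 2%:R in
  if c < m then (m, ab.2) else (ab.1, (ab.1 + m) / 2%:R).
pose I := fix I n := if n is k.+1 then step (f k) (I k) else (0, 1).
have Ilt n : (I n).1 < (I n).2.
  elim: n => [|n IHn] /=; first exact: ltr01.
  by rewrite /step; case: ifP => _ /=; lra.
have Istep n : (I n).1 <= (I n.+1).1 /\ (I n.+1).2 <= (I n).2.
  by have := Ilt n; rewrite /= /step; case: ifP => _ /=; split; lra.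
have Imono n k : (I n).1 <= (I (n + k)%N).1 /\ (I (n + k)%N).2 <= (I n).2.
  elim: k => [|k [IH1 IH2]]; first by rewrite addn0.
  have [S1 S2] := Istep (n + k)%N; rewrite addnS; split.
    exact: le_trans IH1 S1.
  exact: le_trans S2 IH2.
have Ile n k : (I n).1 <= (I k).2.
  have [_ h1] := Imono k n; have [h2 _] := Imono n k.
  by rewrite addnC in h1; apply: le_trans h2 (le_trans (ltW (Ilt _)) h1).
pose E : classical_sets.set R := fun x => exists n, x = (I n).1.
have supE : has_sup E.
  split; first by exists (I 0%N).1; exists 0%N.
  by exists (I 0%N).2 => _ [n ->].
exists (sup E) => n.
have lo k : (I k).1 <= sup E by apply: sup_ubound; [case: supE | exists k].
have hi k : sup E <= (I k).2.
  by apply: ge_sup; [case: supE | move=> _ [j ->]].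
have := lo n.+1; have := hi n.+1; have := Ilt n.
rewrite /= /step; case: ifP => [lt_fm|/negbT] /=.
  by move=> _ _ le_m; rewrite gt_eqF // (lt_le_trans lt_fm).
rewrite -leNgt => le_mf lt_ab le_s _; rewrite lt_eqF //.
by apply: le_lt_trans le_s _; apply: lt_le_trans le_mf; lra.
Qed.

Lemma complex_avoids_roots (R : realType) (I : countType) : avoids_roots (complex R) I.
Proof.
apply: avoids_roots_uncountable => f.
have [x xf] := real_uncountable (fun n => complex.Re (f n)).
exists (x%:C)%C => n; apply: contraNneq (xf n) => <-.
by [].
Qed.

Section Points.
Variable F : closedFieldType.

Lemma mpoly_nonzero_point (k : nat) (p : {mpoly F[k]}) : p != 0 ->
  exists v : 'rV[F]_k, p.@[v ord0] != 0.
Proof.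
move=> p0; have [v vp] := avoid_zeros (@avoids_roots_closed F) (fun _ : unit => p0).
exists (\row_i v i); have := vp tt; congr (_ != _).
by apply: meval_eq => i; rewrite mxE.
Qed.

Lemma mpoly_ext (k : nat) (p q : {mpoly F[k]}) :
  (forall v : 'rV[F]_k, p.@[v ord0] = q.@[v ord0]) -> p = q.
Proof.
move=> pq; apply/eqP; rewrite -subr_eq0; apply: contraT => /mpoly_nonzero_point[v].
by rewrite mevalB pq subrr eqxx.
Qed.

End Points.

(** * Generic truth of algebraic conditions *)

Section GenericTruth.
Variable F : closedFieldType.

Lemma mpoly_term (k : nat) (P : {mpoly F[k]}) :
  exists2 t : GRing.term F, GRing.rterm t &
    forall e : seq F, GRing.eval e t = P.@[fun i => e`_i].
Proof.
elim/mpoly_alg_ind: P => [c|i|p q [t rt tE] [u ru uE]|p q [t rt tE] [u ru uE]].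
- by exists c%:T%T => // e; rewrite mevalC.
- by exists (GRing.Var F i) => // e; rewrite mevalXU.
- exists (t + u)%T => [|e]; first by rewrite /= rt ru.
  by rewrite mevalD /= tE uE.
- exists (t * u)%T => [|e]; first by rewrite /= rt ru.
  by rewrite mevalM /= tE uE.
Qed.

Definition env (k : nat) (c : 'I_k -> F) : seq F := [seq c i | i <- enum 'I_k].

Lemma size_env (k : nat) (c : 'I_k -> F) : size (env c) = k.
Proof. by rewrite size_map size_enum_ord. Qed.

Lemma nth_env (k : nat) (c : 'I_k -> F) (i : 'I_k) : (env c)`_i = c i.
Proof. by rewrite (nth_map i) ?size_enum_ord // nth_ord_enum. Qed.

Lemma term_mpoly (k : nat) (t : GRing.term F) : GRing.rterm t ->
  exists P : {mpoly F[k]}, forall c : 'I_k -> F,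
    GRing.eval (env c) t = P.@[c].
Proof.
elim: t => //=.
- move=> n _; have [lt_nk|le_kn] := ltnP n k.
    exists 'X_(Ordinal lt_nk) => c; rewrite mevalXU.
    by rewrite -[n in LHS]/(val (Ordinal lt_nk)) nth_env.
  by exists 0 => c; rewrite meval0 nth_default // size_env.
- by move=> x _; exists x%:MP => c; rewrite mevalC.
- by move=> n _; exists n%:R%:MP => c; rewrite mevalC.
- move=> t IHt u IHu /andP[/IHt[P PE] /IHu[Q QE]]; exists (P + Q) => c.
  by rewrite mevalD PE QE.
- by move=> t IHt /IHt[P PE]; exists (- P) => c; rewrite mevalN PE.
- by move=> t IHt n /IHt[P PE]; exists (P *+ n) => c; rewrite mevalMn PE.
- move=> t IHt u IHu /andP[/IHt[P PE] /IHu[Q QE]]; exists (P * Q) => c.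
  by rewrite mevalM PE QE.
- move=> t IHt n /IHt[P PE]; exists (P ^+ n) => c.
  by rewrite [meval _ _]rmorphXn /= PE.
Qed.

(** Constructible sets have this property: the condition, or its negation, holds
on a nonempty Zariski open set. *)
Definition generically_decided (k : nat) (B : ('I_k -> F) -> Prop) :=
  exists2 G : {mpoly F[k]}, G != 0 &
    (forall c, G.@[c] != 0 -> B c) \/ (forall c, G.@[c] != 0 -> ~ B c).

(** Quantifier elimination leaves a boolean combination of polynomial equations,
for which the claim is stable under each connective. *)
Lemma generically_decided_holds (k : nat) (f : GRing.formula F) :
  GRing.rformula f ->
  generically_decided (fun c : 'I_k -> F => GRing.holds (env c) f).
Proof.
move=> rf.
pose proj := @ClosedFieldQE.ex_elim F.
have wf_proj : GRing.wf_QE_proj proj by apply: ClosedFieldQE.wf_ex_elim.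
have ok_proj : GRing.valid_QE_proj proj.
  exact/ClosedFieldQE.holds_ex_elim/solve_monicpoly.
have /andP[] := GRing.quantifier_elim_wf wf_proj rf.
have qfP e := GRing.quantifier_elim_rformP wf_proj ok_proj e rf.
move: (GRing.quantifier_elim proj f) qfP => {rf wf_proj ok_proj proj} g qfP qg rg.
suff [G G0 Gg] : generically_decided
    (fun c : 'I_k -> F => GRing.qf_eval (env c) g).
  exists G => //; case: Gg => Gg; [left|right] => c /Gg; first by move/qfP.
  by move=> ng /qfP.
elim: g {f qfP} qg rg => //=.
- move=> [] _ _; exists 1; rewrite ?oner_neq0 //; first by left.
  by right.
- move=> t u _ /andP[/(term_mpoly k)[P PE] /(term_mpoly k)[Q QE]].
  have [eqPQ|neqPQ] := eqVneq P Q.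
    exists 1; rewrite ?oner_neq0 //; left => c _; first by rewrite PE QE eqPQ.
  exists (P - Q); first by rewrite subr_eq0.
  by right=> c; rewrite mevalB subr_eq0 PE QE => /negP.
- move=> f1 IH1 f2 IH2 /andP[q1 q2] /andP[r1 r2].
  have [G1 G10 H1] := IH1 q1 r1; have [G2 G20 H2] := IH2 q2 r2.
  exists (G1 * G2); first by rewrite mulf_neq0.
  case: H1 => H1; last first.
    by right=> c; rewrite mevalM mulf_eq0 => /norP[/H1 h _] /andP[/h].
  case: H2 => H2; last first.
    by right=> c; rewrite mevalM mulf_eq0 => /norP[_ /H2 h] /andP[_ /h].
  by left=> c; rewrite mevalM mulf_eq0 => /norP[/H1 -> /H2 ->].
- move=> f1 IH1 f2 IH2 /andP[q1 q2] /andP[r1 r2].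
  have [G1 G10 H1] := IH1 q1 r1; have [G2 G20 H2] := IH2 q2 r2.
  exists (G1 * G2); first by rewrite mulf_neq0.
  case: H1 => H1.
    by left=> c; rewrite mevalM mulf_eq0 => /norP[/H1 ->].
  case: H2 => H2.
    by left=> c; rewrite mevalM mulf_eq0 => /norP[_ /H2 ->]; rewrite orbT.
  by right=> c; rewrite mevalM mulf_eq0 => /norP[/H1 h1 /H2 h2] /orP[].
- move=> f1 IH1 f2 IH2 /andP[q1 q2] /andP[r1 r2].
  have [G1 G10 H1] := IH1 q1 r1; have [G2 G20 H2] := IH2 q2 r2.
  exists (G1 * G2); first by rewrite mulf_neq0.
  case: H1 => H1; last first.
    by left=> c; rewrite mevalM mulf_eq0 => /norP[/H1 h _]; apply/implyP => /h.
  case: H2 => H2.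
    by left=> c; rewrite mevalM mulf_eq0 => /norP[_ /H2 ->]; apply/implyP.
  by right=> c; rewrite mevalM mulf_eq0 => /norP[/H1 h1 /H2 h2] /implyP /(_ h1).
- move=> f1 IH1 q1 r1; have [G1 G10 H1] := IH1 q1 r1.
  exists G1 => //; case: H1 => H1; [right|left] => c /H1; last by move/negP.
  by move=> ->.
Qed.

Definition glue (k m : nat) (c : 'I_k -> F) (q : 'I_m -> F) (i : 'I_(k + m)) : F :=
  match split i with inl a => c a | inr b => q b end.

(** The projection of a closed set of parameters and nonzero points is
constructible. *)
Lemma generically_decided_common_zero (k m : nat) (J : finType)
    (P : J -> {mpoly F[k + m]}) :
  generically_decided (fun c : 'I_k -> F => exists q : 'I_m -> F,
    (exists i, q i != 0) /\ (forall j, (P j).@[glue c q] = 0)).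
Proof.
have /choice [t tP] j : exists t : GRing.term F, GRing.rterm t /\
    forall e : seq F, GRing.eval e t = (P j).@[fun i => e`_i].
  by have [t rt tE] := mpoly_term (P j); exists t.
pose nz : GRing.formula F := foldr (@GRing.Or F) (@GRing.Bool F false)
  [seq (~ ('X_(k + i) == 0))%T | i : 'I_m <- enum 'I_m].
pose cz : GRing.formula F := foldr (@GRing.And F) (@GRing.Bool F true)
  [seq (t j == 0)%T | j <- enum J].
have rf : GRing.rformula (foldr (@GRing.Exists F) (nz /\ cz)%T (iota k m)).
  have -> s : GRing.rformula (foldr (@GRing.Exists F) (nz /\ cz)%T s) =
              GRing.rformula (nz /\ cz)%T by elim: s.
  apply/andP; split; first by rewrite /nz; elim: (enum _).
  by rewrite /cz; elim: (enum _) => //= j s ->; rewrite (tP j).1.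
have nzP e : GRing.holds e nz <-> exists i : 'I_m, e`_(k + i) != 0.
  transitivity (exists2 i : 'I_m, i \in enum 'I_m & e`_(k + i) != 0); last first.
    by split=> [[i _ h]|[i h]]; exists i; rewrite ?mem_enum.
  rewrite /nz; elim: (enum _) => [|i s IHs] /=; first by split=> // [[]].
  rewrite IHs; split=> [[h|[j js h]]|[j]].
  - by exists i; rewrite ?mem_head //; apply/eqP.
  - by exists j; rewrite // in_cons js orbT.
  - rewrite in_cons => /predU1P[->|js] h; [left; exact/eqP | right].
    by exists j.
have czP e : GRing.holds e cz <-> forall j, (P j).@[fun i => e`_i] = 0.
  transitivity (forall j, j \in enum J -> (P j).@[fun i => e`_i] = 0); last first.
    by split=> h j; [apply: h; rewrite mem_enum | move=> _; apply: h].
  rewrite /cz; elim: (enum _) => [|i s IHs] /=; first by split.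
  rewrite IHs (tP i).2; split=> [[h1 h2] j|h].
    by rewrite in_cons => /predU1P[->|/h2].
  by split=> [|j js]; apply: h; rewrite in_cons ?eqxx ?js ?orbT.
have [G G0 H] := @generically_decided_holds k _ rf.
suff eqB (c : 'I_k -> F) : GRing.holds (env c)
      (foldr (@GRing.Exists F) (nz /\ cz)%T (iota k m)) <->
    (exists q : 'I_m -> F, (exists i, q i != 0) /\ (forall j, (P j).@[glue c q] = 0)).
  by exists G => //; case: H => H; [left|right] => c /H; rewrite eqB.
rewrite -GRing.foldExistsP; split.
  move=> [e' same [/nzP[i i0] /czP Pe']].
  exists (fun i => e'`_(k + i)); split; first by exists i.
  move=> j; rewrite -[RHS](Pe' j); apply: meval_eq => l; rewrite /glue.
  case: splitP => a ->; last by [].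
  rewrite -nth_env; apply: same.
  by rewrite inE /= mem_iota leqNgt ltn_ord.
move=> [q [[i i0] Pq]].
have e'l (l : 'I_(k + m)) : ((env c) ++ env q)`_l = glue c q l.
  rewrite nth_cat size_env /glue; case: splitP => a ->; first by rewrite nth_env.
  by rewrite addKn nth_env.
exists ((env c) ++ env q).
  move=> l; rewrite inE /= mem_iota negb_and -leqNgt -ltnNge => lk.
  rewrite nth_cat size_env; move: lk; case: ltnP => //= le_kl le_l.
  by rewrite !nth_default ?size_env ?leq_subRL.
split.
  apply/nzP; exists i; have := e'l (rshift k i); rewrite /glue.
  case: splitP => a /= ka; first by have := ltn_ord a; rewrite -ka ltnNge leq_addr.
  by move=> ->; rewrite (_ : a = i) //; apply: val_inj; apply: (addnI (esym ka)).
by apply/czP => j; rewrite -[RHS](Pq j); apply: meval_eq => l; apply: e'l.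
Qed.

End GenericTruth.

(** * Elimination of variables in characteristic zero *)

(** Characteristic 0 enters the elimination here: a relation of minimal degree is
separable. *)
Lemma deriv_eq0_size (F : idomainType) (p : {poly F}) : [pchar F] =i pred0 ->
  p^`() = 0 -> (size p <= 1)%N.
Proof.
move=> /pcharf0P char0 dp; apply/leq_sizeP => -[//|j] _.
have := congr1 (fun r : {poly F} => r`_j) dp.
rewrite /= coef_deriv coef0 -mulr_natr => /eqP.
by rewrite mulf_eq0 char0 orbF => /eqP.
Qed.

Section Elimination.
Variables (A : comNzRingType) (F : fieldType).
Hypothesis char0 : [pchar F] =i pred0.
Variables (ev : {rmorphism A -> F}) (q : F).

Let evq (p : {poly A}) := (map_poly ev p).[q].

Let evqD p r : evq (p + r) = evq p + evq r.
Proof. by rewrite /evq rmorphD hornerD. Qed.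

Let evqM p r : evq (p * r) = evq p * evq r.
Proof. by rewrite /evq rmorphM hornerM. Qed.

(** A minimal polynomial of [q], with its denominators cleared.  Minimality is
measured before evaluation of the coefficients, which makes the leading
coefficient survive the evaluation. *)
Lemma minimal_relation :
    (exists2 W, map_poly ev W != 0 & evq W = 0) ->
  exists M : {poly A}, [/\ evq M = 0, evq M^`() != 0, ev (lead_coef M) != 0 &
    forall W : {poly A}, (size W < size M)%N -> evq W = 0 -> map_poly ev W = 0].
Proof.
move=> exW.
pose P k := `[< exists W : {poly A}, [/\ size W = k, map_poly ev W != 0 & evq W = 0] >].
have exP : exists k, P k.
  by case: exW => W W0 Wq; exists (size W); apply/asboolP; exists W.
case: (ex_minnP exP) => s /asboolP [M [sM M0 Mq]] minM {exP exW}.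
have small (W : {poly A}) : (size W < size M)%N -> evq W = 0 -> map_poly ev W = 0.
  move=> sW Wq; apply/eqP/contraT => W0.
  have /minM : P (size W) by apply/asboolP; exists W.
  by rewrite -sM leqNgt sW.
have Mn0 : M != 0 by apply: contraNneq M0 => ->; rewrite rmorph0.
exists M; split=> //.
  (* the derivative of M is too small to be a relation *)
  apply/negP => /eqP /small -/(_ (lt_size_deriv Mn0)).
  rewrite -deriv_map => /(deriv_eq0_size char0) /size1_polyC eM.
  move: Mq M0; rewrite /evq eM hornerC => ->.
  by rewrite polyC0 eqxx.
(* otherwise M without its leading term is a smaller relation *)
apply/negP => /eqP lM0.
have [k sMk] : exists k, size M = k.+1.
  by exists (size M).-1; rewrite prednK // lt0n size_poly_eq0.
pose M' := take_poly k M.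
have eM : map_poly ev M = map_poly ev M'.
  apply/polyP=> j; rewrite !coef_map /= coef_take_poly.
  case: ltnP => // le_kj; rewrite rmorph0.
  move: le_kj; rewrite leq_eqVlt => /predU1P[<-|lt_kj].
    by move: lM0; rewrite lead_coefE sMk.
  by rewrite nth_default ?rmorph0 // sMk.
have sM' : (size M' < size M)%N by rewrite sMk ltnS size_take_poly.
have := small _ sM'; rewrite /evq -eM => /(_ Mq) /eqP.
by rewrite (negbTE M0).
Qed.

Variables (J : Type) (S : J -> Prop) (delta : J -> A -> A) (dd : A -> F).
Hypotheses (deltaD : forall j a b, delta j (a + b) = delta j a + delta j b)
  (deltaM : forall j a b, delta j (a * b) = delta j a * b + a * delta j b)
  (ddD : forall a b, dd (a + b) = dd a + dd b)
  (ddM : forall a b, dd (a * b) = dd a * ev b + ev a * dd b).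

(** One variable, evaluated at [q], is eliminated.  Modulo a minimal relation [M]
of [q], the polynomial [P] is replaced by the remainder [R]; all coefficients
of [R] evaluate to 0.  The derivations of [R] and [P] are proportional at [q],
because the quotient vanishes at [q] by the hypothesis on [P^`()].  Since the
powers of [q] below the degree of [M] are independent over the coefficients,
the derivations [delta j] kill every coefficient of [R], and some coefficient
is not killed by [dd].  If [q] satisfies no relation, [R] is [P] itself.  The
derivation [dd] takes values in the field only, since it stands for a
directional derivative with coefficients outside of the evaluated ring. *)
Lemma eliminate_variable (P : {poly A}) :
    evq P = 0 -> evq P^`() = 0 ->
    (forall j, S j -> evq (map_poly (delta j) P) = 0) ->
    (map_poly dd P).[q] != 0 ->
  exists a, [/\ ev a = 0, forall j, S j -> ev (delta j a) = 0 & dd a != 0].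
Proof.
move=> Pq dPq deltaPq ddPq.
have dd0 : dd 0 = 0 by apply: (addrI (dd 0)); rewrite -ddD !addr0.
have delta0 j : delta j 0 = 0 by apply: (addrI (delta j 0)); rewrite -deltaD !addr0.
suff [R [R0 smallR deltaRq ddRq]] : exists R : {poly A}, [/\ map_poly ev R = 0,
    forall W : {poly A}, (size W <= size R)%N -> evq W = 0 -> map_poly ev W = 0,
    forall j, S j -> evq (map_poly (delta j) R) = 0 & (map_poly dd R).[q] != 0].
  have [l ddRl] : exists l, dd R`_l != 0.
    apply/not_existsP => dR0; case/negP: ddRq.
    rewrite (_ : map_poly dd R = 0) ?horner0 //; apply/polyP=> l.
    by rewrite coef_map_id0 // coef0; apply/eqP; move: (dR0 l) => /negP; rewrite negbK.
  exists R`_l; split=> // [|j Sj].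
    by rewrite -coef_map R0 coef0.
  have /smallR : (size (map_poly (delta j) R) <= size R)%N by apply: size_poly.
  move=> /(_ (deltaRq j Sj)) /(congr1 (fun r : {poly F} => r`_l)).
  by rewrite coef_map /= coef_map_id0 // coef0.
have [exW|nW] := pselect (exists2 W, map_poly ev W != 0 & evq W = 0); last first.
  have all0 W : evq W = 0 -> map_poly ev W = 0.
    by move=> Wq; apply/eqP/contraT => W0; case: nW; exists W.
  by exists P; split=> // [|W _]; apply: all0.
have [M [Mq dMq lM smallM]] := minimal_relation exW.
pose c := lead_coef M ^+ Pdiv.Ring.rscalp P M.
pose D := Pdiv.Ring.rdivp P M; pose R := Pdiv.Ring.rmodp P M.
have divE : c%:P * P = D * M + R by rewrite mul_polyC; apply: Pdiv.ComRing.rdivp_eq.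
have ec : ev c != 0 by rewrite rmorphXn expf_neq0.
have sR : (size R < size M)%N.
  rewrite Pdiv.Ring.ltn_rmodp; apply: contraNneq lM => ->.
  by rewrite lead_coef0 rmorph0.
have R0 : map_poly ev R = 0.
  apply: smallM => //; have := congr1 evq divE.
  by rewrite evqD !evqM Pq Mq !mulr0 add0r => <-.
have Dq : evq D = 0.
  have := congr1 (fun r => evq r^`()) divE.
  rewrite derivD !derivM derivC mul0r add0r !evqD !evqM dPq Mq !mulr0 add0r.
  have -> : evq R^`() = 0 by rewrite /evq -deriv_map R0 deriv0 horner0.
  rewrite addr0 => /esym/eqP.
  by rewrite mulf_eq0 (negbTE dMq) orbF => /eqP.
(* Every derivation of the coefficients sees P and R as proportional at q. *)
have key (d : A -> F) : (forall a b, d (a + b) = d a + d b) ->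
    (forall a b, d (a * b) = d a * ev b + ev a * d b) ->
    (map_poly d R).[q] = ev c * (map_poly d P).[q].
  move=> dD dM.
  have d0 : d 0 = 0 by apply: (addrI (d 0)); rewrite -dD !addr0.
  have mD p r : map_poly d (p + r) = map_poly d p + map_poly d r.
    by apply/polyP=> k; rewrite coefD !coef_map_id0 // coefD dD.
  have := congr1 (fun r => (map_poly d r).[q]) divE.
  rewrite mD !(@map_poly_leibniz _ _ ev) // !hornerD !hornerM.
  rewrite -/(evq P) -/(evq M) -/(evq D) Pq Mq Dq !mulr0 mul0r !add0r => <-.
  by rewrite map_polyC hornerC.
have keyj j : evq (map_poly (delta j) R) = ev c * evq (map_poly (delta j) P).
  have e (r : {poly A}) : map_poly ev (map_poly (delta j) r) = map_poly (ev \o delta j) r.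
    by apply/polyP=> k; rewrite coef_map !coef_map_id0 //= ?delta0 ?rmorph0.
  rewrite /evq !e; apply: key => a b /=; first by rewrite deltaD rmorphD.
  by rewrite deltaM rmorphD !rmorphM.
exists R; split=> // [W sW|j Sj|].
- by apply: smallM; apply: leq_ltn_trans sW sR.
- by rewrite keyj deltaPq // mulr0.
- by rewrite key // mulf_neq0.
Qed.

End Elimination.

Section IntegerPolynomials.
Variable F : fieldType.

(** The variables are indexed by all natural numbers, so that the evaluation point
does not depend on the number of variables. *)
Definition zeval (k : nat) (v : nat -> F) (P : {mpoly int[k]}) : F :=
  mmap intr (fun i : 'I_k => v i) P.

HB.instance Definition _ k v :=
  GRing.RMorphism.copy (@zeval k v) (mmap intr (fun i : 'I_k => v i)).

Lemma zevalX (k : nat) (v : nat -> F) (i : 'I_k) : zeval v 'X_i = v i.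
Proof. by rewrite /zeval mmapX mmap1U. Qed.

Lemma zevalC (k : nat) (v : nat -> F) (c : int) : @zeval k v c%:MP = c%:~R.
Proof. by rewrite /zeval mmapC. Qed.

Lemma zeval_muni (k : nat) (v : nat -> F) (P : {mpoly int[k.+1]}) :
  zeval v P = (map_poly (@zeval k v) (muni P)).[v k].
Proof.
elim/mpoly_alg_ind: P => [c|i|p q IHp IHq|p q IHp IHq].
- by rewrite zevalC muniC map_polyC hornerC /= zevalC.
- rewrite zevalX; case: (ord_widenP i) => [->|[j ->]].
    by rewrite muniXmax map_polyX hornerX.
  by rewrite muniXwiden map_polyC hornerC /= zevalX.
- rewrite muniD [map_poly _ _]raddfD hornerD [zeval _ _]raddfD.
  exact: (congr2 +%R IHp IHq).
- rewrite muniM [map_poly _ _]rmorphM hornerM [zeval _ _]rmorphM.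
  exact: (congr2 *%R IHp IHq).
Qed.

Hypothesis char0 : [pchar F] =i pred0.

(** The variables from [D] on are eliminated, the last one first.  The sum is the
derivative in the direction [beta] of the remaining variables. *)
Lemma eliminate_variables (m D : nat) (v beta : nat -> F) (P : {mpoly int[m + D]}) :
    zeval v P = 0 ->
    (forall j : 'I_(m + D), (D <= j)%N -> zeval v P^`M(j) = 0) ->
    \sum_(i < m + D | (i < D)%N) beta i * zeval v P^`M(i) != 0 ->
  exists2 Q : {mpoly int[D]}, zeval v Q = 0 &
    \sum_(i < D) beta i * zeval v Q^`M(i) != 0.
Proof.
elim: m P => [|m IHm] P Pv dPv bPv.
  by exists P => //; move: bPv; rewrite (eq_bigl predT) // => i; apply: ltn_ord.
pose k := (m + D)%N; pose ev := @zeval k v; pose q := v k.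
have Dk : (D <= k)%N by apply: leq_addl.
pose dd (a : {mpoly int[k]}) := \sum_(i < k | (i < D)%N) beta i * ev a^`M(i).
have ddq (p : {poly {mpoly int[k]}}) : (map_poly dd p).[q] =
    \sum_(i < k | (i < D)%N) beta i * (map_poly ev (map_poly (mderiv i) p)).[q].
  have dd0 : dd 0 = 0.
    by rewrite /dd big1 // => i _; rewrite mderiv0 [ev 0]rmorph0 mulr0.
  rewrite (@horner_coef_wide _ (size p)) ?size_poly //.
  under [RHS]eq_bigr => i _.
    rewrite (@horner_coef_wide _ (size p)); last first.
      by apply: leq_trans (size_poly _ _) (size_poly _ _).
    rewrite big_distrr /=.
    under eq_bigr => l _ do rewrite !coef_map_id0 ?mderiv0 // ?[ev 0]rmorph0 //.
    over.
  rewrite exchange_big /=; apply: eq_bigr => l _.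
  rewrite coef_map_id0 // big_distrl /=.
  by apply: eq_bigr => i _; rewrite mulrA.
have zmuni i : zeval v P^`M(widen_ord (leqnSn k) i) =
    (map_poly ev (map_poly (mderiv i) (muni P))).[q].
  by rewrite zeval_muni muni_mderiv_widen.
have evD a b : ev (a + b) = ev a + ev b by apply: raddfD.
have evM a b : ev (a * b) = ev a * ev b by apply: rmorphM.
have ddD a b : dd (a + b) = dd a + dd b.
  rewrite /dd -big_split /=; apply: eq_bigr => i _.
  by rewrite mderivD evD mulrDr.
have ddM a b : dd (a * b) = dd a * ev b + ev a * dd b.
  rewrite /dd big_distrl big_distrr -big_split /=; apply: eq_bigr => i _.
  by rewrite mderivM evD 2!evM mulrDr mulrA [ev a * (_ * _)]mulrCA.
have P0 : (map_poly ev (muni P)).[q] = 0 by rewrite -zeval_muni.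
have dP0 : (map_poly ev (muni P)^`()).[q] = 0.
  rewrite -muni_mderiv_max -zeval_muni.
  by apply: dPv.
have SP (j : 'I_k) : (D <= j)%N -> (map_poly ev (map_poly (mderiv j) (muni P))).[q] = 0.
  by rewrite -zmuni => Dj; apply: dPv.
have ddP : (map_poly dd (muni P)).[q] != 0.
  rewrite ddq; move: bPv; rewrite -/k big_mkcond big_ord_recr /=.
  rewrite ltnNge Dk addr0 -big_mkcond.
  by under eq_bigr => i _ do rewrite zmuni.
have [a [a0 Sa da]] := eliminate_variable char0 (fun j => @mderivD _ _ j)
  (fun j => @mderivM _ _ j) ddD ddM P0 dP0 SP ddP.
exact: IHm a a0 Sa da.
Qed.

End IntegerPolynomials.

(** * The theorem of Bertini *)

Section MoreIntegerPolynomials.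
Variable F : fieldType.

Lemma zeval_meval (k : nat) (v : nat -> F) (Q : {mpoly int[k]}) :
  zeval v Q = (map_mpoly intr Q).@[fun i : 'I_k => v i].
Proof.
elim/mpoly_alg_ind: Q => [c|i|p q IHp IHq|p q IHp IHq].
- by rewrite zevalC map_mpolyC /= ?mevalC.
- by rewrite zevalX map_mpolyX mevalXU.
- rewrite [zeval _ _]raddfD [map_mpoly _ _]raddfD mevalD.
  exact: (congr2 +%R IHp IHq).
- rewrite [zeval _ _]rmorphM [map_mpoly _ _]rmorphM mevalM.
  exact: (congr2 *%R IHp IHq).
Qed.

Variables (k K : nat).

Definition shifted_variable (j : 'I_k) : 'I_(k + K) :=
  cast_ord (addnC K k) (rshift K j).

Definition shift (g : {mpoly int[k]}) : {mpoly int[k + K]} :=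
  g \mPo [tuple 'X_(shifted_variable j) | j < k].

Lemma zeval_shift (v : nat -> F) (g : {mpoly int[k]}) :
  zeval v (shift g) = zeval (fun t => v (K + t)%N) g.
Proof.
elim/mpoly_alg_ind: g => [c|i|p q IHp IHq|p q IHp IHq].
- by rewrite /shift comp_mpolyC !zevalC.
- by rewrite /shift comp_mpolyXU -tnth_nth tnth_mktuple !zevalX.
- rewrite /shift comp_mpolyD 2![zeval _ (_ + _)]raddfD.
  exact: (congr2 +%R IHp IHq).
- rewrite /shift [_ \mPo _]rmorphM 2![zeval _ (_ * _)]rmorphM.
  exact: (congr2 *%R IHp IHq).
Qed.

Lemma zeval_mderiv_shift (v : nat -> F) (g : {mpoly int[k]}) (j : 'I_k) :
  zeval v (shift g)^`M(shifted_variable j) = zeval (fun t => v (K + t)%N) g^`M(j).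
Proof.
elim/mpoly_alg_ind: g => [c|i|p q IHp IHq|p q IHp IHq].
- by rewrite /shift comp_mpolyC !mderivC /zeval !mmap0.
- rewrite /shift comp_mpolyXU -tnth_nth tnth_mktuple !mderivXU !zevalC.
  by rewrite (inj_eq (@cast_ord_inj _ _ _)) (inj_eq (@rshift_inj _ _)).
- rewrite /shift comp_mpolyD 2!mderivD 2![zeval _ (_ + _)]raddfD.
  exact: (congr2 +%R IHp IHq).
- rewrite /shift [_ \mPo _]rmorphM 2!mderivM 2![zeval _ (_ + _)]raddfD.
  rewrite /= 4![zeval _ (_ * _)]rmorphM /=.
  exact: (congr2 +%R (congr2 *%R IHp (zeval_shift v q)) (congr2 *%R (zeval_shift v p) IHq)).
Qed.

Lemma mderiv_shift (g : {mpoly int[k]}) (a : 'I_K) :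
  (shift g)^`M(widen_ord (leq_addl k K) a) = 0.
Proof.
elim/mpoly_alg_ind: g => [c|i|p q IHp IHq|p q IHp IHq].
- by rewrite /shift comp_mpolyC mderivC.
- rewrite /shift comp_mpolyXU -tnth_nth tnth_mktuple mderivXU.
  by rewrite -val_eqE /= gtn_eqF ?ltn_addr.
- rewrite /shift comp_mpolyD mderivD; move: IHp IHq; rewrite /shift => -> ->.
  by rewrite addr0.
- rewrite /shift [_ \mPo _]rmorphM mderivM.
  transitivity (0 * shift q + shift p * 0); last by rewrite mul0r mulr0 addr0.
  exact: (congr2 +%R (congr2 *%R IHp erefl) (congr2 *%R erefl IHq)).
Qed.

Lemma zeval_monomial (v : nat -> F) (m : 'X_{1..k}) :
  zeval v 'X_[m] = ('X_[m] : {mpoly F[k]}).@[fun i : 'I_k => v i].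
Proof. by rewrite zeval_meval map_mpolyX. Qed.

Lemma zeval_mderiv_monomial (v : nat -> F) (m : 'X_{1..k}) (j : 'I_k) :
  zeval v ('X_[m])^`M(j) = (('X_[m] : {mpoly F[k]})^`M(j)).@[fun i : 'I_k => v i].
Proof. by rewrite zeval_meval -mderiv_map_mpoly map_mpolyX. Qed.

End MoreIntegerPolynomials.

Section Bertini.
Variables (F : closedFieldType) (k D : nat).
Hypothesis char0 : [pchar F] =i pred0.

Definition member (b : 'I_D -> {mpoly F[k]}) (tau : 'I_D -> F) : {mpoly F[k]} :=
  \sum_i tau i *: b i.

(** A countable family that contains all integer polynomials. *)
Definition decode_mpoly (K : nat) (s : seq (int * K.-tuple nat)) : {mpoly int[K]} :=
  \sum_(x <- s) x.1 *: 'X_[[multinom tnth x.2 i | i < K]].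

Lemma decode_mpoly_onto (K : nat) (Q : {mpoly int[K]}) : exists s, decode_mpoly s = Q.
Proof.
exists [seq (Q@_m, [tuple m i | i < K]) | m <- msupp Q].
rewrite /decode_mpoly big_map [RHS]mpolyE; apply: eq_bigr => m _ /=.
by congr (_ *: 'X_[_]); apply/mnmP => i; rewrite mnmE tnth_mktuple.
Qed.

Variables (d : nat) (b : 'I_D -> {mpoly F[k]}).
Hypothesis b_size : forall i, (msize (b i) <= d)%N.

Local Notation T := 'X_{1..k < d}.
Local Notation K := #|{: T}|.
Let alpha (a : 'I_K) : 'X_{1..k} := bmnm (enum_val a).
Let B : 'M[F]_(D, K) := \matrix_(i, a) (b i)@_(alpha a).

Let mpoly_alpha (p : {mpoly F[k]}) : (msize p <= d)%N ->
  p = \sum_(a < K) p@_(alpha a) *: 'X_[alpha a].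
Proof.
move=> /mpolywE {1}->; rewrite (reindex (@enum_val T predT)) //=.
exact/onW_bij/enum_val_bij.
Qed.

(** Bertini: the polynomials [G] are the nonzero [Q(tau B)], where [Q] is an
integer polynomial in the coefficients of a form and [B] is the matrix of the
coefficients of the forms [b i].  If the member [tau] is singular at [q] and
[b i] is not 0 at [q], elimination of the coordinates of [q] from the universal
form gives a [Q] whose value at [tau B] is 0 while its [i]-th derivative is not,
so that [Q(tau B)] is a nonzero polynomial that vanishes at [tau]. *)
Lemma generic_singularity_in_base_locus :
  exists (I : countType) (G : I -> {mpoly F[D]}), (forall i, G i != 0) /\
    forall tau : 'I_D -> F, (forall i, (G i).@[tau] != 0) ->
    forall q : 'I_k -> F, (member b tau).@[q] = 0 ->
      (forall j, (member b tau)^`M(j).@[q] = 0) -> forall i, (b i).@[q] = 0.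
Proof.
pose GQ (Q : {mpoly int[K]}) : {mpoly F[D]} := linear_subst B (map_mpoly intr Q).
pose G (s : seq (int * K.-tuple nat)) : {mpoly F[D]} :=
  let Q := GQ (decode_mpoly s) in if Q == 0 then 1 else Q.
exists (seq (int * K.-tuple nat)), G; split.
  by move=> s; rewrite /G /=; case: ifP => [_|/negbT //]; apply: oner_neq0.
move=> tau tauG q q0 dq0 i; apply/eqP/contraT => bq.
pose rtau : 'rV[F]_D := \row_j tau j.
pose w : 'I_K -> F := (rtau *m B) ord0.
pose v t := (env w ++ env q)`_t.
have vw (a : 'I_K) : v a = w a.
  by rewrite /v nth_cat size_env ltn_ord nth_env.
have vq (j : 'I_k) : v (K + j)%N = q j.
  by rewrite /v nth_cat size_env ltnNge leq_addr addKn nth_env.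
have sE : member b tau = \sum_(a < K) w a *: 'X_[alpha a].
  rewrite [LHS]mpoly_alpha; last first.
    rewrite /member; elim/big_rec: _ => [|j p _ ps]; first by rewrite msize0.
    apply: leq_trans (msizeD_le _ _) _; rewrite geq_max ps andbT.
    exact: leq_trans (msizeZ_le _ _) (b_size j).
  apply: eq_bigr => a _; congr (_ *: _); rewrite /member raddf_sum /w mxE.
  by apply: eq_bigr => j _; rewrite /= mcoeffZ !mxE.
pose wv (a : 'I_K) : 'I_(k + K) := widen_ord (leq_addl k K) a.
(* the universal form: its coefficients are the first K variables *)
pose P : {mpoly int[k + K]} := \sum_(a < K) 'X_(wv a) * shift K 'X_[alpha a].
have mono (m : 'X_{1..k}) : zeval (fun t => v (K + t)%N) 'X_[m] =
    ('X_[m] : {mpoly F[k]}).@[q].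
  by rewrite zeval_monomial; apply: meval_eq => j; rewrite vq.
have dmono (m : 'X_{1..k}) j : zeval (fun t => v (K + t)%N) ('X_[m])^`M(j) =
    (('X_[m] : {mpoly F[k]})^`M(j)).@[q].
  by rewrite zeval_mderiv_monomial; apply: meval_eq => j'; rewrite vq.
have zsum (I : Type) (r : seq I) (p : I -> {mpoly int[k + K]}) :
    zeval v (\sum_(x <- r) p x) = \sum_(x <- r) zeval v (p x).
  exact: raddf_sum.
have zM (p p' : {mpoly int[k + K]}) : zeval v (p * p') = zeval v p * zeval v p'.
  exact: rmorphM.
have zD (p p' : {mpoly int[k + K]}) : zeval v (p + p') = zeval v p + zeval v p'.
  exact: raddfD.
have dsum (t : 'I_(k + K)) : P^`M(t) = \sum_(a < K) ('X_(wv a) * shift K 'X_[alpha a])^`M(t).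
  exact: (big_morph _ (mderivD t) (mderiv0 _ t)).
have Pv : zeval v P = 0.
  rewrite zsum -[RHS]q0 sE (big_morph _ (mevalD q) (meval0 q)).
  by apply: eq_bigr => a _; rewrite zM zevalX vw zeval_shift mono mevalZ.
have dPv (t : 'I_(k + K)) : (K <= t)%N -> zeval v P^`M(t) = 0.
  move=> Kt; have tk : (t - K < k)%N by rewrite -(ltn_add2l K) subnKC // (leq_trans (ltn_ord t)) // addnC.
  have -> : t = shifted_variable K (Ordinal tk).
    by apply: val_inj; rewrite /= subnKC.
  rewrite dsum zsum -[RHS](dq0 (Ordinal tk)) sE.
  rewrite (big_morph _ (mderivD _) (mderiv0 _ _)) (big_morph _ (mevalD q) (meval0 q)).
  apply: eq_bigr => a _; rewrite mderivM zD 2!zM zevalX mderivXU zevalC.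
  rewrite zeval_mderiv_shift dmono vw mderivZ mevalZ.
  rewrite (_ : wv a == _ = false) ?mul0r ?add0r //.
  by rewrite -val_eqE /= ltn_eqF // ltn_addr.
(* the direction of the coefficients of b i *)
pose beta t := (env (B i))`_t.
have bPv : \sum_(t < k + K | (t < K)%N) beta t * zeval v P^`M(t) != 0.
  rewrite (big_ord_narrow (leq_addl k K)).
  rewrite (_ : \sum_(a < K) _ = (b i).@[q]) //.
  rewrite [in RHS](mpoly_alpha (b_size i)) (big_morph _ (mevalD q) (meval0 q)).
  apply: eq_bigr => a _; rewrite mevalZ /beta nth_env mxE; congr (_ * _).
  rewrite dsum zsum (bigD1 a) //= big1 ?addr0 => [|a' a'a].
    rewrite mderivM mderiv_shift mulr0 addr0 mderivXU eqxx zM zevalC mul1r.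
    by rewrite zeval_shift mono.
  rewrite mderivM mderiv_shift mulr0 addr0 mderivXU zM zevalC.
  by rewrite -val_eqE /= val_eqE (negbTE a'a) mul0r.
have [Q Qv] := eliminate_variables char0 Pv dPv bPv.
rewrite (_ : \sum_(a < K) _ = (GQ Q)^`M(i).@[tau]); last first.
  have -> : (GQ Q)^`M(i).@[tau] = (GQ Q)^`M(i).@[rtau ord0].
    by apply: meval_eq => j; rewrite mxE.
  rewrite mderiv_linear_subst; apply: eq_bigr => a _; rewrite /beta nth_env.
  rewrite mderiv_map_mpoly zeval_meval; congr (_ * _).
  by apply: meval_eq => a'; rewrite vw.
have [s sQ] := decode_mpoly_onto Q.
have := tauG s; rewrite /G sQ /=; case: (eqVneq (GQ Q) 0) => [->|_]; first by rewrite mderiv0 meval0 eqxx.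
have -> : (GQ Q).@[tau] = (GQ Q).@[rtau ord0].
  by apply: meval_eq => j; rewrite mxE.
rewrite meval_linear_subst; case/eqP; rewrite -[RHS]Qv zeval_meval.
by apply: meval_eq => a'; rewrite vw.
Qed.

End Bertini.

(** * General members of a linear system *)

Section GeneralMember.
Variables (F : closedFieldType) (m d : nat).
Local Notation E := (dhomog m.+1 F d).
Variable V : {vspace E}.
Local Notation D := (\dim V).

Definition basis_vector (t : 'I_D) : E := (vbasis V)`_t.

Definition combination (c : 'I_D -> F) : E := \sum_t c t *: basis_vector t.

Lemma combination_mem c : combination c \in V.
Proof.
apply: rpred_sum => t _; apply: rpredZ; apply: vbasis_mem.
by apply: mem_nth; rewrite size_tuple.
Qed.

Lemma combination_coord s : s \in V -> s = combination (fun t => coord (vbasis V) t s).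
Proof. exact: coord_vbasis. Qed.

Lemma coord_combination c t : coord (vbasis V) t (combination c) = c t.
Proof. exact: (coord_sum_free _ _ (basis_free (vbasisP V))). Qed.

(** The homogeneous components of [G] define the open set.  If one of them is not 0
at [s], then [G] is not identically 0 on the line spanned by [s], and the
property descends from a multiple of [s]. *)
Lemma general_of_generic (W Q : E -> Prop) (G : {mpoly F[D]}) :
    subspace_of W V -> (0 < D)%N ->
    (forall a s, a != 0 -> Q (a *: s) -> Q s) -> G != 0 ->
    (forall c, G.@[c] != 0 -> Q (combination c)) ->
  general W Q.
Proof.
move=> WV D0 Qscale G0 GQ; exists V => //.
pose Z (g : {mpoly F[D]}) := exists j, g = pihomog mdeg j G.
pose U s := exists2 g, Z g & g.@[fun i => coord (vbasis V) i s] != 0.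
have GE : G = \sum_(j < msize G) pihomog mdeg j G.
  exact: (pihomog_partitionE (leqnn _)).
exists U; split.
- exists Z; split=> // g [j ->]; exists j; exact: pihomogP.
- have [c cG] : exists c : 'I_D -> F, forall i : unit, (G * 'X_(Ordinal D0)).@[c] != 0.
    apply: avoid_zeros (@avoids_roots_closed F) _ (fun _ => G * 'X_(Ordinal D0)) _ => _.
    rewrite mulf_neq0 //; apply/eqP => /(congr1 (fun p : {mpoly F[D]} => p@_U_(Ordinal D0)%MM)).
    by rewrite mcoeffXU eqxx mcoeff0 => /eqP; rewrite oner_eq0.
  have := cG tt; rewrite mevalM mulf_eq0 negb_or mevalXU => /andP[Gc c0].
  exists (combination c); split; first exact: combination_mem.
    by apply: contraNneq c0 => e; rewrite -coord_combination e linear0.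
  have [j Gj] : exists j : nat, (pihomog mdeg j G).@[c] != 0.
    apply/not_existsP => all0; case/negP: Gc; rewrite GE.
    rewrite (big_morph _ (mevalD c) (meval0 c)) big1 // => j _.
    by apply/eqP; move: (all0 j) => /negP; rewrite negbK.
  exists (pihomog mdeg j G); first by exists j.
  by rewrite (@meval_eq _ _ _ c) // => t; apply: coord_combination.
move=> s sV s0 [_ [j ->]]; set c := (fun i => _) => Gjc.
(* along the line through c, G is a nonzero polynomial in the parameter *)
pose p : {poly F} := \poly_(i < msize G) (pihomog mdeg i G).@[c].
have pE a : p.[a] = G.@[fun i => a * c i].
  rewrite horner_poly [in RHS]GE (big_morph _ (mevalD _) (meval0 _)).
  by apply: eq_bigr => i _; rewrite (meval_homogZ _ _ (pihomogP _ _ _)) mulrC.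
have p0 : p != 0.
  apply: contraNneq Gjc => /(congr1 (fun q : {poly F} => q`_j)).
  rewrite coef_poly coef0; case: ltnP => [_ -> //|le_j _].
  rewrite (_ : pihomog mdeg j G = 0) ?meval0 //.
  rewrite [in LHS]GE raddf_sum big1 // => i _ /=.
  apply: (pihomog_ne0 _ (pihomogP _ _ _)).
  by rewrite ltn_eqF // (leq_trans (ltn_ord i)).
have /closed_nonrootP [a] : p * 'X != 0 by rewrite mulf_neq0 ?polyX_eq0.
rewrite rootM rootX negb_or => /andP[pa a0].
apply: (Qscale a) => //; rewrite (combination_coord sV) -/c.
have -> : a *: combination c = combination (fun i => a * c i).
  by rewrite /combination scaler_sumr; apply: eq_bigr => i _; rewrite scalerA.
by apply: GQ; rewrite -pE.
Qed.

(** A functional that is not 0 on [V] gives one more hypersurface of the parameter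
space that a general member avoids. *)
Lemma functional_avoidance (phi : E -> F) :
    (forall a s t, phi (a *: s + t) = a * phi s + phi t) ->
    (exists2 s, s \in V & phi s != 0) ->
  exists2 g : {mpoly F[D]}, g != 0 & forall c, g.@[c] = phi (combination c).
Proof.
move=> phi_lin [s sV phis].
have phi0 : phi 0 = 0.
  have := phi_lin (-1) 0 0; rewrite scaler0 addr0 mulN1r addNr => h.
  exact: h.
have phi_comb c : phi (combination c) = \sum_t c t * phi (basis_vector t).
  rewrite /combination; elim/big_rec2: _ => // t y x _ <-.
  exact: phi_lin.
pose g := linear_form (\col_t phi (basis_vector t)).
have gE c : g.@[c] = phi (combination c).
  rewrite phi_comb /g /linear_form (big_morph _ (mevalD c) (meval0 c)).
  by apply: eq_bigr => t _; rewrite mevalZ mevalXU mxE mulrC.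
exists g => //; apply: contraNneq phis => g0.
by rewrite (combination_coord sV) -gE g0 meval0.
Qed.

End GeneralMember.

Lemma smooth_hypersurface_scale (F : closedFieldType) (k d : nat) (a : F)
    (s : dhomog k F d) :
  a != 0 -> smooth_hypersurface (a *: s) -> smooth_hypersurface s.
Proof.
move=> a0 [s0 sm]; split.
  by apply: contraNneq s0 => e; rewrite /= e scaler0.
move=> q q0 sq; have [|i] := sm q q0; first by rewrite /= mevalZ sq mulr0.
by rewrite /= mderivZ mevalZ mulf_eq0 negb_or => /andP[_ ?]; exists i.
Qed.

(** Being singular is the existence of a common zero of forms whose coefficients
are linear in the coordinates of the member. *)
Lemma generically_smooth_decided (F : closedFieldType) (m d : nat)
    (V : {vspace dhomog m.+1 F d}) :
  generically_decided (fun c => exists q : 'I_m.+1 -> F, (exists i, q i != 0) /\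
    ((combination (V:=V) c : {mpoly F[m.+1]}).@[q] = 0 /\
     forall j, ((combination (V:=V) c : {mpoly F[m.+1]})^`M(j)).@[q] = 0)).
Proof.
pose D := \dim V.
pose X t : {mpoly F[D + m.+1]} := 'X_(lshift m.+1 t).
pose sub (f : {mpoly F[m.+1]}) : {mpoly F[D + m.+1]} :=
  f \mPo [tuple 'X_(rshift D i) | i < m.+1].
pose P (j : option 'I_m.+1) : {mpoly F[D + m.+1]} := \sum_(t < D)
  X t * sub (if j is Some i then (basis_vector t : {mpoly F[m.+1]})^`M(i) else basis_vector t).
have PE j c q : (P j).@[glue c q] = \sum_(t < D) c t *
    (if j is Some i then (basis_vector t : {mpoly F[m.+1]})^`M(i) else basis_vector t).@[q].
  rewrite (big_morph _ (mevalD _) (meval0 _)); apply: eq_bigr => t _.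
  rewrite mevalM mevalXU comp_mpoly_meval /glue; congr (_ * _).
    by rewrite (unsplitK (inl t)).
  apply: meval_eq => i; rewrite tnth_mktuple mevalXU.
  by rewrite (unsplitK (inr i)).
have cE c : mpoly_of_dhomog (combination c) = \sum_(t < D) c t *: mpoly_of_dhomog (basis_vector t).
  by rewrite /combination raddf_sum.
have [G G0 H] := generically_decided_common_zero P.
exists G => //.
suff eqB c : (exists q : 'I_m.+1 -> F, (exists i, q i != 0) /\
    forall j, (P j).@[glue c q] = 0) <->
  (exists q : 'I_m.+1 -> F, (exists i, q i != 0) /\
    ((combination (V:=V) c : {mpoly F[m.+1]}).@[q] = 0 /\
     forall j, ((combination (V:=V) c : {mpoly F[m.+1]})^`M(j)).@[q] = 0)).
  by case: H => H; [left|right] => c /H; rewrite eqB.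
have e0 q : (P None).@[glue c q] = (combination (V:=V) c : {mpoly F[m.+1]}).@[q].
  rewrite PE cE (big_morph _ (mevalD _) (meval0 _)); apply: eq_bigr => t _.
  by rewrite mevalZ.
have e1 q j : (P (Some j)).@[glue c q] = ((combination (V:=V) c : {mpoly F[m.+1]})^`M(j)).@[q].
  rewrite PE cE (big_morph _ (mderivD _) (mderiv0 _ _)) (big_morph _ (mevalD _) (meval0 _)).
  by apply: eq_bigr => t _; rewrite mderivZ mevalZ.
split=> [[q [q0 Pq]]|[q [q0 [s0 sq]]]]; exists q; split=> //.
  by split=> [|j]; rewrite -?e0 -?e1.
by case=> [j|]; rewrite ?e0 ?e1.
Qed.

(** * Cones and hyperplanes *)

Section Cones.
Variables (F : closedFieldType) (k d : nat).

Lemma msizeM_bound (f g : {mpoly F[k]}) (a b : nat) :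
  (msize f <= a.+1)%N -> (msize g <= b)%N -> (msize (f * g) <= a + b)%N.
Proof.
move=> fa gb; have [->|f0] := eqVneq f 0; first by rewrite mul0r msize0.
have [->|g0] := eqVneq g 0; first by rewrite mulr0 msize0.
rewrite msizeM //; apply: leq_trans (_ : (a.+1 + b).-1 <= _)%N => //.
by rewrite -!subn1 leq_sub2r // leq_add.
Qed.

Lemma msize_homog (f : {mpoly F[k]}) : f \is d.-homog -> (msize f <= d.+1)%N.
Proof.
move=> /dhomogP hf; rewrite msizeE; apply/bigmax_leqP_seq => u uf _.
by have := hf u uf => /= ->.
Qed.

(** A product of linear factors changes under a translation by terms of lower
degree only. *)
Lemma translate_lower_terms (f : {mpoly F[k]}) (p : 'rV[F]_k) : f \is d.-homog ->
  (msize (translate f p - f) <= d)%N.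
Proof.
move=> /dhomogP hf; rewrite /translate; set T := [tuple _ | _ < _].
pose close e (g : {mpoly F[k]}) := (msize g <= e.+1)%N /\ (msize (g \mPo T - g) <= e)%N.
have closeM a b (g h : {mpoly F[k]}) : close a g -> close b h -> close (a + b)%N (g * h).
  move=> [ga dg] [hb dh]; split; first by rewrite -addnS; apply: msizeM_bound.
  have -> : g * h \mPo T - g * h = (h \mPo T) * (g \mPo T - g) + g * (h \mPo T - h).
    rewrite [g * h \mPo T]rmorphM /= !mulrBr [(h \mPo T) * g]mulrC.
    by rewrite addrA subrK mulrC.
  apply: leq_trans (msizeD_le _ _) _; rewrite geq_max; apply/andP; split.
    rewrite addnC; apply: msizeM_bound => //.
    rewrite -(subrK h (h \mPo T)); apply: leq_trans (msizeD_le _ _) _.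
    by rewrite geq_max hb (leq_trans dh).
  exact: msizeM_bound.
have closeX i : close 1%N 'X_i.
  split; first by rewrite msizeX mdeg1.
  rewrite comp_mpolyXU -tnth_nth tnth_mktuple addrC addKr.
  by rewrite msizeC; case: (_ != 0).
have close1 : close 0%N 1.
  by split; rewrite ?msize1 // comp_mpoly1 subrr msize0.
have closeXm m : close (mdeg m) 'X_[m].
  rewrite mpolyXE_id mdegE; elim/big_rec2: _ => // i e g _ ch.
  apply: (closeM) => //; elim: (m i) => [|l IHl]; first by rewrite expr0.
  by rewrite exprS -add1n; apply: (closeM).
rewrite {1 2}[f]mpolyE raddf_sum -sumrB.
rewrite big_seq; elim/big_rec: _ => [|m g mf gd]; first by rewrite msize0.
apply: leq_trans (msizeD_le _ _) _; rewrite geq_max gd andbT /=.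
rewrite comp_mpolyZ -scalerBr; apply: leq_trans (msizeZ_le _ _) _.
have [_] := closeXm m; have /= -> := hf m mf.
by [].
Qed.

(** The terms of [f(p + X)] of degree less than [d] vanish by the multiplicity, the
others are those of [f]; so [f(p + X) = f].  Homogeneity turns translations
by [p] into translations by its multiples. *)
Lemma cone_translation_invariant (f : {mpoly F[k]}) (p : 'rV[F]_k) :
    f \is d.-homog -> has_multiplicity f p d ->
  forall (a : F) (y : 'rV[F]_k), f.@[(y + a *: p) ord0] = f.@[y ord0].
Proof.
move=> hf [multf _].
have tf : translate f p = f.
  apply/eqP; rewrite -subr_eq0; apply/eqP/mpolyP => u; rewrite mcoeff0.
  have [lt_ud|le_du] := ltnP (mdeg u) d; last first.
    by apply: memN_msupp_eq0; apply: msize_mdeg_ge; apply: leq_trans (translate_lower_terms p hf) le_du.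
  rewrite mcoeffB (dhomog_nemf_coeff hf) /= ?ltn_eqF // subr0.
  by apply: memN_msupp_eq0; apply: contraL lt_ud => /multf; rewrite -leqNgt.
have tr1 (y : 'rV[F]_k) : f.@[(y + p) ord0] = f.@[y ord0].
  rewrite -{2}tf comp_mpoly_meval; apply: meval_eq => i.
  by rewrite tnth_mktuple mevalD mevalXU mevalC mxE.
move=> a y; have [->|a0] := eqVneq a 0; first by rewrite scale0r addr0.
have scale (z : 'rV[F]_k) : f.@[(a *: z) ord0] = a ^+ d * f.@[z ord0].
  by rewrite -(meval_homogZ _ _ hf); apply: meval_eq => i; rewrite mxE.
have -> : y = a *: (a^-1 *: y) by rewrite scalerA divff // scale1r.
by rewrite -scalerDr !scale tr1.
Qed.

(** Any point off the cone can be moved along [p] into the hyperplane [c]. *)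
Lemma cone_section_nonzero (f : {mpoly F[k]}) (p : 'rV[F]_k) (c : 'cV[F]_k) :
    f != 0 -> f \is d.-homog -> has_multiplicity f p d -> p *m c != 0 ->
  exists2 y : 'rV[F]_k, y *m c = 0 & f.@[y ord0] != 0.
Proof.
move=> f0 hf mf pc; have [y fy] := mpoly_nonzero_point f0.
have pc0 : (p *m c) 0 0 != 0.
  by apply: contra pc => /eqP e; apply/eqP/matrixP => i j; rewrite !ord1 e mxE.
pose a := - ((y *m c) 0 0 / (p *m c) 0 0).
exists (y + a *: p); last by rewrite (cone_translation_invariant hf mf).
apply/matrixP => i j; rewrite !ord1 mulmxDl -scalemxAl mxE [X in _ + X]mxE.
by rewrite /a mulNr divfK // subrr mxE.
Qed.

End Cones.

Section Hyperplanes.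
Variables (F : closedFieldType) (n : nat).
Implicit Types (H : 'M[F]_(n.+1, n.+2)) (c : 'cV[F]_n.+2).

(** The column [c] holds the coefficients of an equation of the hyperplane. *)
Definition equation H c := forall y : 'rV[F]_n.+2, (y <= H)%MS = (y *m c == 0).

Lemma hyperplane_equation H : row_free H -> exists c, equation H c.
Proof.
move=> fH; have rH : \rank H = n.+1 by apply/eqP.
have kn0 : kermx H^T != 0.
  by rewrite -mxrank_eq0 mxrank_ker mxrank_tr rH subSn // subnn.
have [u] := rowV0Pn kn0; move=> /sub_kermxP uH u0; exists u^T => y.
have HK : (H <= kermx u^T)%MS.
  by apply/sub_kermxP; rewrite -[H]trmxK -trmx_mul uH trmx0.
have rK : \rank (kermx u^T) = n.+1.
  by rewrite mxrank_ker mxrank_tr rank_rV u0 subn1.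
have KH : (kermx u^T <= H)%MS.
  by rewrite -(mxrank_leqif_sup HK) rH rK.
apply/idP/eqP => [yH|/sub_kermxP yK]; last exact: submx_trans KH.
by apply/sub_kermxP; apply: submx_trans HK.
Qed.

Lemma equation_kills H c : equation H c -> H *m c = 0.
Proof.
move=> eqHc; apply/row_matrixP => i; rewrite row_mul row0.
by apply/eqP; rewrite -eqHc row_sub.
Qed.

Lemma equation_normalized H c : row_free H -> equation H c ->
  exists w : 'rV[F]_n.+2, w *m c = 1%:M.
Proof.
move=> fH eqHc; have c0 : c != 0.
  apply/eqP => c0; have : (1%:M <= H)%MS.
    by apply/row_subP => i; rewrite eqHc c0 mulmx0.
  by move/mxrankS; rewrite mxrank1 (eqP fH) ltnn.
have /matrix0Pn [i [j cij]] := c0.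
rewrite (ord1 j) in cij; exists ((c i 0)^-1 *: delta_mx 0 i).
rewrite -scalemxAl -rowE; apply/matrixP => a b.
by rewrite !ord1 !mxE mulVf.
Qed.

Lemma restriction_linear_form H c :
  restriction H (linear_form c) = linear_form (H *m c).
Proof.
apply: mpoly_ext => v.
by rewrite [LHS]meval_linear_subst !meval_linear_form mulmxA.
Qed.

(** Compose with the coordinates of a projection to [H]. *)
Lemma restriction_onto H (d : nat) (g : {mpoly F[n.+1]}) : row_free H ->
  g \is d.-homog -> exists2 f, f \is d.-homog & restriction H f = g.
Proof.
move=> fH hg; exists (linear_subst (pinvmx H) g); first exact: linear_subst_homog.
apply: mpoly_ext => v; rewrite [LHS]meval_linear_subst meval_linear_subst.
by rewrite -mulmxA mulmxVp // mulmx1.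
Qed.

(** Let [y] be the coordinates on [H] of a projection [x - l(x) v] to [H], where
[l] is the equation.  Then [f(x)] is congruent modulo [l] to the restriction
of [f] at [y]. *)
Lemma restriction_eq0_dvd H c f : row_free H -> equation H c ->
  restriction H f = 0 -> exists g, f = linear_form c * g.
Proof.
move=> fH eqHc fH0; have [w wc] := equation_normalized fH eqHc.
pose B := pinvmx H; pose E := 1%:M - B *m H; pose v := w *m E.
have HE : H *m E = 0 by rewrite /E mulmxBr mulmx1 mulmxA mulmxVp // mul1mx subrr.
have EE : E = c *m v.
  apply/row_matrixP => i; rewrite !rowE mulmxA.
  set x := delta_mx 0 i : 'rV_n.+2.
  have : (x - x *m c *m w <= H)%MS.
    by rewrite eqHc mulmxBl -[x *m c *m w *m c]mulmxA wc mulmx1 subrr.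
  move=> /submxP [D xE]; rewrite -[x in LHS](subrK (x *m c *m w)) mulmxDl xE.
  by rewrite -(mulmxA D) HE mulmx0 add0r /v mulmxA.
pose T (M : 'M[F]_n.+2) := [tuple \sum_(i < n.+2) M i j *: 'X_i | j < n.+2].
have [|g fE] := @comp_mpoly_congr _ _ _ [tuple 'X_i | i < n.+2] (T (B *m H))
  [tuple (v 0 j)%:MP | j < n.+2] (linear_form c) f.
  move=> j; rewrite !tnth_mktuple; apply: mpoly_ext => x.
  rewrite mevalD mevalM mevalC meval_linear_form mevalXU.
  rewrite (big_morph _ (mevalD _) (meval0 _)).
  under eq_bigr => i _ do rewrite mevalZ mevalXU mulrC.
  have xE : x = x *m (B *m H) + (x *m c) 0 0 *: v.
    rewrite -mul_scalar_mx -mx11_scalar -mulmxA -EE mulmxBr mulmx1.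
    by rewrite addrC subrK.
  by rewrite {1}xE mxE [X in X + _]mxE [X in _ + X]mxE.
exists g; rewrite comp_mpoly_id in fE; rewrite {1}fE.
rewrite (_ : f \mPo T (B *m H) = 0) ?add0r //.
apply: mpoly_ext => x; rewrite [LHS]meval_linear_subst meval0 mulmxA.
by rewrite -(meval_linear_subst H f) [linear_subst H f]fH0 meval0.
Qed.

End Hyperplanes.

(** * Linear systems of a suited family *)

Section SpanDimension.
Variables (F : closedFieldType) (m d : nat).

Lemma proj_dim_line (X : dhomog m.+1 F d) (W : dhomog m.+1 F d -> Prop) :
  X != 0 -> (forall s, W s <-> exists a, s = a *: X) -> proj_dim W 0.
Proof.
move=> X0 WE; exists <[X]>%VS; last by rewrite dim_vline X0.
move=> s; rewrite WE; split=> [/vlineP[a ->]|[a ->]]; first by exists a.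
by apply/vlineP; exists a.
Qed.

(** The sum of the line of [X] and of the image of the multiplication by [p] is
direct. *)
Lemma proj_dim_span (e : nat) (X : dhomog m.+1 F d) (p : {mpoly F[m.+1]})
    (W : dhomog m.+1 F d -> Prop) :
    (e <= d)%N -> p != 0 -> p \is e.-homog ->
    (forall g : dhomog m.+1 F (d - e), X <> p * g :> {mpoly F[m.+1]}) ->
    (forall s, W s <-> exists a (g : dhomog m.+1 F (d - e)),
       s = a *: (X : {mpoly F[m.+1]}) + p * g :> {mpoly F[m.+1]}) ->
  proj_dim W 'C(d - e + m, m).
Proof.
move=> led p0 hp Xp WE.
have mul_homog (g : dhomog m.+1 F (d - e)) : p * g \is d.-homog.
  rewrite -[X in X.-homog](subnKC led); apply: dhomogM => //.
  exact: dhomog_is_dhomog.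
pose mu (g : dhomog m.+1 F (d - e)) : dhomog m.+1 F d := DHomog (mul_homog g).
have mu_linear : linear mu.
  by move=> a g h; apply: val_inj => /=; rewrite mulrDr scalerAr.
pose muL : {linear dhomog m.+1 F (d - e) -> dhomog m.+1 F d} :=
  HB.pack mu (GRing.isLinear.Build _ _ _ _ mu mu_linear).
pose f := linfun muL.
have fE g : f g = mu g by rewrite lfunE.
exists (<[X]> + limg f)%VS.
  move=> s; rewrite WE; split.
    move=> /memv_addP[_ /vlineP[a ->] [_ /memv_imgP[g _ ->] ->]].
    by exists a, g; rewrite fE.
  move=> [a [g sE]]; have -> : s = a *: X + f g by apply: val_inj; rewrite fE.
  by rewrite memv_add ?memvZ ?memv_line ?memv_img ?memvf.
have X0 : X != 0.
  by apply/eqP => X0; apply: (Xp 0); rewrite X0 mulr0.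
rewrite dimv_disjoint_sum.
  rewrite dim_vline X0 limg_dim_eq.
    rewrite dimvf add1n; congr (_.+1); rewrite [dim _]/=.
    by rewrite -[RHS]bin_sub ?leq_addl // addnK.
  apply/eqP; rewrite -subv0; apply/subvP => g /memv_capP[_].
  rewrite memv_ker fE memv0 => /eqP/(congr1 val)/= /eqP.
  by rewrite mulf_eq0 (negbTE p0).
apply/eqP; rewrite -subv0; apply/subvP => s /memv_capP[/vlineP[a ->]].
move=> /memv_imgP[g _]; rewrite fE => /(congr1 val) /= aX.
have [->|a0] := eqVneq a 0; first by rewrite scale0r mem0v.
case: (Xp (a^-1 *: g)) => /=.
by rewrite -scalerAr -aX scalerA mulVf // scale1r.
Qed.

End SpanDimension.

Section SchemeScalars.
Variables (F : closedFieldType) (n d : nat).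

(** A cofactor of degree 0 is a constant. *)
Lemma zero_scheme_sub_scalar (f g : {mpoly F[n]}) :
    f != 0 -> f \is d.-homog -> g \is d.-homog -> zero_scheme_sub f g ->
  exists a, g = a *: f.
Proof.
move=> f0 hf hg [h gE]; rewrite gE in hg.
have [a hE] := homog_same_degree f0 hf hg.
by exists a; rewrite gE hE mul_mpolyC.
Qed.

Lemma scalar_zero_scheme_eq (f : {mpoly F[n]}) (a : F) :
  a != 0 -> zero_scheme_eq (a *: f) f.
Proof.
move=> a0; split; last by exists a%:MP; rewrite mul_mpolyC.
by exists a^-1%:MP; rewrite mul_mpolyC scalerA mulVf // scale1r.
Qed.

End SchemeScalars.

Lemma cone_avoids_hyperplane (F : closedFieldType) (n d : nat) (T : triple F n d)
    (c : 'cV[F]_n.+2) :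
    in_Pd T -> vertex T *m c != 0 ->
  exists2 y : 'rV[F]_n.+1, y *m hplane T *m c = 0 & (mpoly_of_dhomog (cone T)).@[y ord0] != 0.
Proof.
move=> [_ _ vT [C0 multC _]] vc.
have vc' : vertex T *m pinvmx (hplane T) *m (hplane T *m c) != 0.
  by rewrite mulmxA mulmxKpV.
have [y yc Cy] := @cone_section_nonzero _ _ _ (mpoly_of_dhomog (cone T)) _ _
  C0 (dhomog_is_dhomog _) multC vc'.
by exists y => //; rewrite -mulmxA.
Qed.

Section Suited.
Variables (F : closedFieldType) (n d e : nat) (L : 'I_e -> triple F n d).
Hypotheses (e_gt0 : (0 < e)%N) (LPd : forall i, in_Pd (L i)).
Hypothesis Lsep : forall i j, i != j -> ~~ (vertex (L i) <= hplane (L j))%MS.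
Variables (c : 'I_e -> 'cV[F]_n.+2) (X : dhomog n.+2 F d) (u : 'I_e -> F).
Hypothesis cE : forall i, equation (hplane (L i)) (c i).
Hypothesis u0 : forall i, u i != 0.
Hypothesis XE : forall i,
  restriction (hplane (L i)) X = u i *: (cone (L i) : {mpoly F[n.+1]}).

Local Notation Xp := (mpoly_of_dhomog X).
Local Notation V i := (hplane (L i)).
Local Notation C i := (mpoly_of_dhomog (cone (L i))).

Definition hyperplane_product : {mpoly F[n.+2]} := \prod_(i < e) linear_form (c i).
Local Notation l := hyperplane_product.

Let freeV i : row_free (V i). Proof. by case: (LPd i). Qed.

Let C0 i : C i != 0. Proof. by case: (LPd i) => _ _ _ []. Qed.

Lemma vertex_off i j : i != j -> vertex (L i) *m c j != 0.
Proof. by move=> /Lsep; rewrite cE. Qed.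

Lemma vertex_on i : vertex (L i) *m c i = 0.
Proof. by apply/eqP; rewrite -cE; case: (LPd i). Qed.

Lemma linear_form_neq0 (k : nat) (b : 'cV[F]_k) : b != 0 -> linear_form b != 0.
Proof.
move=> /matrix0Pn [i [j bij]]; apply: contraNneq bij => /(congr1 (mderiv i)).
by rewrite mderiv_linear_form mderiv0 ord1 => /eqP; rewrite mpolyC_eq0 => /eqP ->.
Qed.

Lemma equation_neq0 H b : row_free H -> @equation F n H b -> b != 0.
Proof.
move=> fH Hb; have [w wb] := equation_normalized fH Hb.
by apply/eqP => b0; move: wb; rewrite b0 mulmx0 => /eqP; rewrite eq_sym oner_eq0.
Qed.

Lemma hyperplane_product_homog : l \is e.-homog.
Proof.
have := homog_prod_const (fun i => linear_form_homog (c i)).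
by rewrite sum1_card card_ord.
Qed.

Lemma hyperplane_product_neq0 : l != 0.
Proof.
by apply/prodf_neq0 => i _; apply/linear_form_neq0/(equation_neq0 (freeV i)).
Qed.

Lemma restriction_product i : restriction (V i) l = 0.
Proof.
rewrite [LHS]linear_subst_prod (bigD1 i) //= -/(restriction _ _).
rewrite [linear_subst _ _]restriction_linear_form equation_kills //.
by rewrite /linear_form big1 ?mul0r // => j _; rewrite mxE scale0r.
Qed.

(** The equations are divided out one by one: the equation of [V j] does not
vanish at the vertex of [L i] if [j] is not [i], hence not on [V i], and the
coordinate ring of [V i] is a domain. *)
Lemma product_dvd f : (forall i, restriction (V i) f = 0) -> exists g, f = l * g.
Proof.
move=> fV; suff [g fE] : exists g, f = (\prod_(i <- index_enum 'I_e) linear_form (c i)) * g.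
  by exists g.
elim: (index_enum _) (index_enum_uniq 'I_e) => [|i r IHr] /=.
  by exists f; rewrite big_nil mul1r.
case/andP=> ir /IHr[g fE]; rewrite big_cons.
have [|g' gE] := @restriction_eq0_dvd _ _ (V i) (c i) g (freeV i) (cE i).
  have := fV i; rewrite fE [restriction _ _]linear_substM linear_subst_prod => /eqP.
  rewrite mulf_eq0 => /orP[|/eqP //]; rewrite prodf_seq_eq0.
  case/hasP=> j jr /= /eqP/(congr1 (meval ((vertex (L i) *m pinvmx (V i)) ord0))).
  rewrite meval_linear_subst meval0 mulmxKpV; last by case: (LPd i).
  have ij : i != j by apply: contraNneq ir => ->.
  rewrite meval_linear_form => v0; case/eqP: (vertex_off ij).
  by apply/matrixP => a b; rewrite !ord1 v0 mxE.
by exists g'; rewrite fE gE mulrA [_ * linear_form _]mulrC.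
Qed.

Lemma X_section_neq0 i (b : 'cV[F]_n.+2) : vertex (L i) *m b != 0 ->
  exists z : 'rV[F]_n.+2, [/\ z *m c i = 0, z *m b = 0 & Xp.@[z ord0] != 0].
Proof.
move=> vb; have [y yb Cy] := cone_avoids_hyperplane (LPd i) vb.
exists (y *m V i); split=> //; first by rewrite -mulmxA equation_kills // mulmx0.
rewrite -meval_linear_subst [linear_subst _ _]XE mevalZ.
by rewrite mulf_neq0.
Qed.

(** The scalars [a i] agree because [X] does not vanish identically on the
intersection of two hyperplanes of the family. *)
Lemma Vd_decomposition (s : dhomog n.+2 F d) : Vd L s ->
  exists a g, s = a *: Xp + l * g :> {mpoly F[n.+2]}.
Proof.
move=> sV.
have /choice[a aE] i : exists a, restriction (V i) (mpoly_of_dhomog s - a *: Xp) = 0.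
  have [|a sE] := zero_scheme_sub_scalar (C0 i) (dhomog_is_dhomog _) _ (sV i).
    exact/linear_subst_homog/dhomog_is_dhomog.
  exists (a / u i); rewrite [restriction _ _]linear_substB linear_substZ.
  by rewrite [linear_subst _ X]XE [linear_subst _ s]sE scalerA divfK // subrr.
pose i0 := Ordinal e_gt0.
have aa i : a i = a i0.
  have [->//|ne] := eqVneq i i0.
  have [z [zi zi0 Xz]] := X_section_neq0 (vertex_off ne).
  have sz j : z *m c j = 0 -> (mpoly_of_dhomog s).@[z ord0] = a j * Xp.@[z ord0].
    move=> /eqP; rewrite -cE => /submxP[y zE]; apply/eqP.
    rewrite -subr_eq0 -mevalZ -mevalB zE -meval_linear_subst.
    by rewrite [linear_subst _ _]aE meval0.
  by apply: (mulIf Xz); rewrite -!sz.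
have [|g gE] := @product_dvd (mpoly_of_dhomog s - a i0 *: Xp).
  by move=> i; rewrite -(aa i) aE.
by exists (a i0), g; rewrite -gE addrC subrK.
Qed.

Lemma Vd_combination (s : dhomog n.+2 F d) a g :
  s = a *: Xp + l * g :> {mpoly F[n.+2]} -> Vd L s.
Proof.
move=> sE i; exists (a * u i)%:MP.
rewrite sE [restriction _ _]linear_substD linear_substZ linear_substM.
rewrite [linear_subst _ X]XE [linear_subst _ l]restriction_product.
by rewrite mul0r addr0 scalerA mul_mpolyC.
Qed.

Lemma VdP_le (s : dhomog n.+2 F d) : (e <= d)%N ->
  Vd L s <-> exists a (g : dhomog n.+2 F (d - e)),
    s = a *: Xp + l * g :> {mpoly F[n.+2]}.
Proof.
move=> led; split=> [/Vd_decomposition[a [g sE]]|[a [g]]]; last exact: Vd_combination.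
suff hg : g \is (d - e).-homog by exists a, (DHomog hg).
apply: (homog_cofactor hyperplane_product_neq0 hyperplane_product_homog).
rewrite (subnKC led) (_ : l * g = mpoly_of_dhomog s - a *: Xp).
  by apply: rpredB; [|apply: rpredZ]; apply: dhomog_is_dhomog.
by rewrite sE addrC addKr.
Qed.

Lemma VdP_gt (s : dhomog n.+2 F d) : (d < e)%N ->
  Vd L s <-> exists a, s = a *: X.
Proof.
move=> lde; split=> [/Vd_decomposition[a [g sE]]|[a ->]]; last first.
  by apply: (@Vd_combination _ a 0); rewrite mulr0 addr0.
exists a; apply: val_inj; rewrite /= sE.
rewrite (_ : l * g = 0) ?addr0 //; apply: (homog_cofactor_lt lde hyperplane_product_homog).
rewrite (_ : l * g = mpoly_of_dhomog s - a *: Xp).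
  by apply: rpredB; [|apply: rpredZ]; apply: dhomog_is_dhomog.
by rewrite sE addrC addKr.
Qed.

Lemma Vd_proj_dim :
  proj_dim (Vd L) (if (e <= d)%N then 'C(d - e + n.+1, n.+1) else 0%N).
Proof.
pose i0 := Ordinal e_gt0.
have Xi0 : restriction (V i0) X != 0.
  by rewrite XE scaler_eq0 negb_or u0 C0.
case: leqP => [led|lde].
  apply: (proj_dim_span (X := X) led hyperplane_product_neq0 hyperplane_product_homog).
    move=> g Xg; case/eqP: Xi0.
    by rewrite Xg [LHS]linear_substM [linear_subst _ l]restriction_product mul0r.
  by move=> s; apply: VdP_le.
apply: (@proj_dim_line _ _ _ X); last by move=> s; apply: VdP_gt.
by apply: contraNneq Xi0 => ->; rewrite [restriction _ _]comp_mpoly0.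
Qed.

Section RestrictedSystem.
Variables (H : 'M[F]_(n.+1, n.+2)).
Hypotheses (freeH : row_free H) (vH : forall i, ~~ (vertex (L i) <= H)%MS).

Lemma section_neq0 i : H *m c i != 0.
Proof.
apply/eqP => Hc; have HV : (H <= V i)%MS.
  by apply/row_subP => j; rewrite cE -row_mul Hc row0.
have VH : (V i <= H)%MS.
  by rewrite -(mxrank_leqif_sup HV) (eqP freeH) (eqP (freeV i)).
case/negP: (vH i); apply: submx_trans VH.
by case: (LPd i).
Qed.

Lemma restriction_productE :
  restriction H l = \prod_(i < e) linear_form (H *m c i).
Proof.
rewrite [LHS]linear_subst_prod; apply: eq_bigr => i _.
exact: restriction_linear_form.
Qed.

Lemma restricted_product_neq0 : restriction H l != 0.
Proof.
rewrite restriction_productE; apply/prodf_neq0 => i _.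
exact/linear_form_neq0/section_neq0.
Qed.

Lemma restricted_product_homog : restriction H l \is e.-homog.
Proof. exact/linear_subst_homog/hyperplane_product_homog. Qed.

(** At a point of [H] and of some [V i] where [X] is not 0, the product vanishes. *)
Lemma restricted_independent a g : a *: restriction H Xp = restriction H l * g -> a = 0.
Proof.
move=> aX; have [b Hb] := hyperplane_equation freeH.
pose i0 := Ordinal e_gt0.
have vb : vertex (L i0) *m b != 0 by rewrite -Hb.
have [z [zi zb Xz]] := X_section_neq0 vb.
have /submxP [y zE] : (z <= H)%MS by rewrite Hb zb.
apply: (mulIf Xz); rewrite mul0r zE -meval_linear_subst -mevalZ.
rewrite [_ *: linear_subst _ _]aX mevalM meval_linear_subst -zE.
by rewrite [l.@[_]]rmorph_prod (bigD1 i0) //= meval_linear_form zi mxE !mul0r.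
Qed.

Definition restricted_X : dhomog n.+1 F d :=
  DHomog (linear_subst_homog H (dhomog_is_dhomog X)).

Lemma restrictedP_le (f : dhomog n.+1 F d) : (e <= d)%N ->
  Vd_restricted L H f <-> exists a (g : dhomog n.+1 F (d - e)),
    f = a *: mpoly_of_dhomog restricted_X + restriction H l * g :> {mpoly F[n.+1]}.
Proof.
move=> led; split.
  move=> [s /(VdP_le _ led)[a [g sE]] ->].
  exists a, (DHomog (linear_subst_homog H (dhomog_is_dhomog g))).
  by rewrite sE [LHS]linear_substD linear_substZ linear_substM.
move=> [a [g fE]]; have [g' hg' g'E] := restriction_onto freeH (dhomog_is_dhomog g).
have hs : a *: Xp + l * g' \is d.-homog.
  apply: rpredD; first by apply: rpredZ; apply: dhomog_is_dhomog.
  by have := dhomogM hyperplane_product_homog hg'; rewrite (subnKC led).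
exists (DHomog hs); first exact: Vd_combination.
by rewrite fE [RHS]linear_substD linear_substZ linear_substM [linear_subst H g']g'E.
Qed.

Lemma restricted_proj_dim_le : (e <= d)%N ->
  proj_dim (fun f : dhomog n.+1 F d => Vd_restricted L H f) 'C(d - e + n, n).
Proof.
move=> led; apply: (proj_dim_span (X := restricted_X) led restricted_product_neq0
    restricted_product_homog).
  move=> g Xg; have /eqP : 1 = 0 :> F; last by rewrite oner_eq0.
  by apply: (@restricted_independent 1 g); rewrite scale1r.
by move=> s; apply: restrictedP_le.
Qed.

Lemma restricted_proj_dim_gt : (d < e)%N ->
  proj_dim (fun f : dhomog n.+1 F d => Vd_restricted L H f) 0.
Proof.
move=> lde; apply: (@proj_dim_line _ _ _ restricted_X).
  apply/eqP => X0; have /eqP : 1 = 0 :> F; last by rewrite oner_eq0.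
  apply: (@restricted_independent 1 0); rewrite scale1r mulr0.
  exact: (congr1 val X0).
move=> f; split.
  move=> [s /(VdP_gt _ lde)[a sE] fE]; exists a; apply: val_inj.
  by rewrite /= fE sE [LHS]linear_substZ.
move=> [a fE]; exists (a *: X); first by apply/(VdP_gt _ lde); exists a.
by rewrite fE [RHS]linear_substZ.
Qed.

(** Linear forms with the same zeros are proportional. *)
Lemma section_equation_scalar i (h : dhomog n.+1 F 1) :
  section_equation H (V i) h ->
  exists t, mpoly_of_dhomog h = t *: linear_form (H *m c i).
Proof.
move=> hE; have [b hb] : exists b, mpoly_of_dhomog h = linear_form b.
  by eexists; apply/homog1_linear_form/dhomog_is_dhomog.
have hz (y : 'rV[F]_n.+1) : y *m b = 0 <-> y *m (H *m c i) = 0.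
  have e0 : y *m b = 0 <-> (mpoly_of_dhomog h).@[y ord0] = 0.
    rewrite hb meval_linear_form; split=> [->|y0]; first by rewrite mxE.
    by apply/matrixP => j k; rewrite !ord1 y0 mxE.
  by rewrite e0 hE cE mulmxA; split=> [/eqP|->].
have /matrix0Pn [j [k]] := section_neq0 i; rewrite (ord1 k).
set t := (H *m c i) j 0 => t0.
exists ((b j 0) / t); rewrite hb; apply: mpoly_ext => y.
rewrite mevalZ !meval_linear_form; set q := (y *m (H *m c i)) 0 0.
pose x : 'rV[F]_n.+1 := y - (q / t) *: delta_mx 0 j.
have : x *m (H *m c i) = 0.
  apply/matrixP => a a'; rewrite !ord1 mulmxBl -scalemxAl -rowE.
  rewrite [LHS]mxE [X in _ + X]mxE [X in - X]mxE [X in _ * X]mxE -/q -/t.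
  by rewrite divfK // subrr mxE.
move=> /hz; rewrite mulmxBl -scalemxAl -rowE => /matrixP /(_ 0 0).
rewrite [LHS]mxE [X in _ + X]mxE [X in - X]mxE [X in _ * X]mxE [RHS]mxE.
move=> /eqP; rewrite subr_eq0 => /eqP ->.
by rewrite mulrAC [RHS]mulrC mulrA.
Qed.

Lemma restricted_contains (led : (e <= d)%N) (h : 'I_e -> dhomog n.+1 F 1)
    (g : dhomog n.+1 F (d - e)) :
    (forall i, section_equation H (V i) (h i)) ->
  Vd_restricted L H ((\prod_(i < e) mpoly_of_dhomog (h i)) * mpoly_of_dhomog g).
Proof.
move=> hE; have /choice [t tE] i := section_equation_scalar (hE i).
under eq_bigr => i _ do rewrite tE.
rewrite scaler_prod -restriction_productE.
set T := \prod_(i < e) t i.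
have hf : (T *: restriction H l) * g \is d.-homog.
  rewrite -[X in X.-homog](subnKC led); apply: dhomogM; last exact: dhomog_is_dhomog.
  by apply: rpredZ; apply: restricted_product_homog.
apply/(@restrictedP_le (DHomog hf) led); exists 0, (T *: g).
by rewrite scale0r add0r /= -scalerAl scalerAr.
Qed.

End RestrictedSystem.

Section GeneralSmooth.
Hypotheses (char0 : [pchar F] =i pred0)
  (avoidF : forall I : countType, avoids_roots F I) (led : (e <= d)%N).

Lemma product_member (k : 'I_n.+2) :
  exists2 s : dhomog n.+2 F d, Vd L s &
    mpoly_of_dhomog s = l * 'X_k ^+ (d - e).
Proof.
have hs : l * 'X_k ^+ (d - e) \is d.-homog.
  rewrite -[in d.-homog](subnKC led); apply: dhomogM; first exact: hyperplane_product_homog.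
  have := dhomogMn (d - e) (_ : ('X_k : {mpoly F[n.+2]}) \is 1.-homog).
  by rewrite mul1n; apply; rewrite dhomogX /= mdeg1.
exists (DHomog hs) => //.
by apply: (@Vd_combination _ 0 ('X_k ^+ (d - e))); rewrite scale0r add0r.
Qed.

Lemma X_member : Vd L X.
Proof.
by apply: (@Vd_combination _ 1 0); rewrite scale1r mulr0 addr0.
Qed.

Lemma base_point_on_hyperplane (q : 'rV[F]_n.+2) : q != 0 ->
    (forall s, Vd L s -> (mpoly_of_dhomog s).@[q ord0] = 0) ->
  (mpoly_of_dhomog X).@[q ord0] = 0 /\ exists i, (q <= hplane (L i))%MS.
Proof.
move=> /matrix0Pn [r [k]]; rewrite (ord1 r) => qk base.
split; first exact/base/X_member.
have [s /base sq sE] := product_member k.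
move: sq; rewrite sE mevalM [X in _ * X]rmorphXn /= mevalXU => /eqP.
rewrite mulf_eq0 [X in _ || X]expf_eq0 (negbTE qk) andbF orbF.
rewrite [l.@[_]]rmorph_prod => /prodf_eq0 [i _] /=; rewrite meval_linear_form => /eqP qi.
by exists i; rewrite cE; apply/eqP/matrixP => a b; rewrite !ord1 qi mxE.
Qed.

(** The other factors of [hyperplane_product c] do not vanish at the vertex, so that
[l g] has the differential of the factor [i], up to a nonzero scalar, as soon as
[g] is not 0 there. *)
Lemma differential_at_vertex (i : 'I_e) :
  exists (k : 'I_n.+2) (s : dhomog n.+2 F d), Vd L s /\
    ((mpoly_of_dhomog s)^`M(k)).@[(vertex (L i)) ord0] != 0.
Proof.
have [_ v0 _ _] := LPd i.
have /matrix0Pn [k [k' ck]] := equation_neq0 (freeV i) (cE i).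
rewrite (ord1 k') in ck.
have /matrix0Pn [r [k1]] := v0; rewrite (ord1 r) => vk.
have [s sV sE] := product_member k1; exists k, s; split=> //.
rewrite sE /hyperplane_product (bigD1 i) //= -mulrA mderivM mevalD !mevalM.
rewrite meval_linear_form vertex_on mxE mul0r addr0.
rewrite mderiv_linear_form mevalC mulf_neq0 // mulf_neq0 //.
  rewrite [X in X != 0]rmorph_prod; apply/prodf_neq0 => j ji /=.
  rewrite meval_linear_form; apply: contra (@vertex_off i j _).
    by move=> /eqP e0; apply/eqP/matrixP => a b; rewrite !ord1 e0 mxE.
  by rewrite eq_sym.
by rewrite [X in X != 0]rmorphXn /= mevalXU expf_neq0.
Qed.

(** Off the vertex, a singular point of [s] on the hyperplane would be singular on
the section of [s], which is a nonzero multiple of the cone. *)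
Lemma smooth_at_base_point (s : dhomog n.+2 F d) (i : 'I_e) (k : 'I_n.+2) (z q : 'rV[F]_n.+2) :
    Vd L s ->
    z *m c i = 0 -> (mpoly_of_dhomog s).@[z ord0] != 0 ->
    ((mpoly_of_dhomog s)^`M(k)).@[(vertex (L i)) ord0] != 0 ->
    q != 0 -> (q <= hplane (L i))%MS -> (mpoly_of_dhomog X).@[q ord0] = 0 ->
  exists j, ((mpoly_of_dhomog s)^`M(j)).@[q ord0] != 0.
Proof.
move=> sV zi sz sv q0 qi Xq.
have [_ v0 vV [_ _ smoothC]] := LPd i.
have [y yE] := submxP qi.
have [yp|yp] := boolP (y <= vertex (L i) *m pinvmx (hplane (L i)))%MS.
  have /sub_rVP [t yt] := yp.
  have qt : q = t *: vertex (L i) by rewrite yE yt -scalemxAl mulmxKpV.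
  have t0 : t != 0 by apply: contraNneq q0 => t0; rewrite qt t0 scale0r.
  exists k; have hk := mderiv_homog k (dhomog_is_dhomog s).
  rewrite (@meval_eq _ _ _ (fun j => t * (vertex (L i)) ord0 j)); last first.
    by move=> j; rewrite qt mxE.
  by rewrite (meval_homogZ _ _ hk) mulf_neq0 // expf_neq0.
have y0 : y != 0 by apply: contraNneq q0 => y0; rewrite yE y0 mul0mx.
have Cy : (mpoly_of_dhomog (cone (L i))).@[y ord0] = 0.
  apply/eqP; move/eqP: Xq; rewrite yE -meval_linear_subst [linear_subst _ _]XE mevalZ.
  by rewrite mulf_eq0 (negbTE (u0 i)).
have [j Cj] := smoothC y y0 yp Cy.
have [h sE] := sV i.
have [a hE] : exists a, restriction (hplane (L i)) s = a *: mpoly_of_dhomog (cone (L i)).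
  apply: (zero_scheme_sub_scalar (C0 i) (dhomog_is_dhomog _) _ (sV i)).
  exact/linear_subst_homog/dhomog_is_dhomog.
have a0 : a != 0.
  have /submxP [x zE] : (z <= hplane (L i))%MS by rewrite cE zi.
  apply: contraNneq sz => a0; rewrite zE -meval_linear_subst [linear_subst _ _]hE.
  by rewrite a0 scale0r meval0.
apply/not_existsP => all0.
have : ((restriction (hplane (L i)) s)^`M(j)).@[y ord0] != 0.
  by rewrite hE mderivZ mevalZ mulf_neq0.
rewrite [X in X != 0]mderiv_linear_subst -yE big1 ?eqxx // => t _.
by move: (all0 t) => /negP; rewrite negbK => /eqP ->; rewrite mulr0.
Qed.

(** The parameter [tau] avoids the countably many polynomials of Bertini's theorem,
the functionals attached to the vertices and to the hyperplanes, and the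
polynomial [G] that decides smoothness: the member [tau] is smooth, so [G]
cannot decide for singular members. *)
Lemma general_smooth :
  general (Vd L) (fun s : dhomog n.+2 F d => smooth_hypersurface s).
Proof.
have [V WV dimV] := Vd_proj_dim.
have D0 : (0 < \dim V)%N by rewrite dimV.
have VE s : s \in V <-> Vd L s by apply: WV.
have [G G0 decG] := generically_smooth_decided V.
have [I [B [B0 bertini]]] := generic_singularity_in_base_locus char0
  (b := fun t : 'I_(\dim V) => mpoly_of_dhomog (basis_vector t))
  (fun t => msize_homog (dhomog_is_dhomog (basis_vector t))).
(* at each vertex, a functional that keeps the differential nonzero *)
have /choice [k /choice [A Aprop]] i : exists k, exists A : {mpoly F[\dim V]}, A != 0 /\
    forall t, A.@[t] = ((mpoly_of_dhomog (combination t))^`M(k)).@[(vertex (L i)) ord0].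
  have [k [s [sV sk]]] := differential_at_vertex i; exists k.
  have [||A A0 AE] := @functional_avoidance _ _ _ V
    (fun s : dhomog n.+2 F d => ((mpoly_of_dhomog s)^`M(k)).@[(vertex (L i)) ord0]).
  - by move=> a s1 s2; rewrite /= mderivD mderivZ mevalD mevalZ.
  - by exists s => //; apply/VE.
  by exists A.
(* at each hyperplane, a functional that keeps the restriction nonzero *)
have /choice [z /choice [A' A'prop]] i : exists z : 'rV[F]_n.+2,
    exists A : {mpoly F[\dim V]}, [/\ z *m c i = 0, A != 0 &
    forall t, A.@[t] = (mpoly_of_dhomog (combination t)).@[z ord0]].
  have [y Cy] := mpoly_nonzero_point (C0 i); exists (y *m hplane (L i)).
  have [||A1 A10 A1E] := @functional_avoidance _ _ _ V
    (fun s : dhomog n.+2 F d => (mpoly_of_dhomog s).@[(y *m hplane (L i)) ord0]).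
  - by move=> a s1 s2; rewrite /= mevalD mevalZ.
  - exists X; first by apply/VE/X_member.
    by rewrite -meval_linear_subst [linear_subst _ _]XE mevalZ mulf_neq0.
  by exists A1; split=> //; rewrite -mulmxA equation_kills // mulmx0.
pose fam (x : option (I + ('I_e + 'I_e))) : {mpoly F[\dim V]} :=
  match x with
  | None => G | Some (inl j) => B j | Some (inr (inl i)) => A i
  | Some (inr (inr i)) => A' i
  end.
have [|tau tauP] := avoid_zeros (avoidF (I := option (I + ('I_e + 'I_e)))) (P := fam).
  case=> [[j|[i|i]]|] //=; first by case: (Aprop i).
  by case: (A'prop i).
case: decG => [bad|good].
  have [q [q0 [sq dsq]]] := bad tau (tauP None).
  pose r : 'rV[F]_n.+2 := \row_j q j.
  have rE (f : {mpoly F[n.+2]}) : f.@[r ord0] = f.@[q].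
    by apply: meval_eq => j; rewrite mxE.
  have sE : mpoly_of_dhomog (combination tau) =
      member (fun t : 'I_(\dim V) => mpoly_of_dhomog (basis_vector t)) tau.
    by rewrite /combination raddf_sum.
  have base (t : 'I_(\dim V)) : (mpoly_of_dhomog (basis_vector t)).@[q] = 0.
    have := bertini tau (fun j => tauP (Some (inl j))) q.
    by rewrite -sE => /(_ sq dsq t).
  have baseV s : Vd L s -> (mpoly_of_dhomog s).@[r ord0] = 0.
    move=> /VE /combination_coord ->; rewrite rE /combination raddf_sum.
    rewrite (big_morph _ (mevalD q) (meval0 q)) big1 // => t _ /=.
    by rewrite mevalZ base mulr0.
  have r0 : r != 0.
    have [j qj] := q0; apply: contraNneq qj => e0.
    by have := congr1 (fun M : 'rV[F]_n.+2 => M 0 j) e0; rewrite !mxE => ->.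
  have [Xr [i ri]] := base_point_on_hyperplane r0 baseV.
  have sV : Vd L (combination tau) by apply/VE/combination_mem.
  have [zi _ A'E] := A'prop i; have [_ AE] := Aprop i.
  have sz : (mpoly_of_dhomog (combination tau)).@[(z i) ord0] != 0.
    by rewrite -A'E; apply: (tauP (Some (inr (inr i)))).
  have sv : ((mpoly_of_dhomog (combination tau))^`M(k i)).@[(vertex (L i)) ord0] != 0.
    by rewrite -AE; apply: (tauP (Some (inr (inl i)))).
  have [j] := smooth_at_base_point sV zi sz sv r0 ri Xr.
  by rewrite rE dsq eqxx.
have i0 := Ordinal e_gt0.
apply: (general_of_generic WV D0 (G := G * A i0)) => [a s||t].
- exact: smooth_hypersurface_scale.
- by rewrite mulf_neq0 //; case: (Aprop i0).
rewrite mevalM mulf_eq0 negb_or (Aprop i0).2 => /andP[/good nbad sv].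
split.
  by apply: contraNneq sv => ->; rewrite mderiv0 meval0.
move=> q q0 sq; apply/not_existsP => all0; apply: nbad; exists (q ord0); split.
  by have /matrix0Pn [r [j]] := q0; rewrite (ord1 r); exists j.
split=> // j; apply/eqP; move: (all0 j) => /negP.
by rewrite negbK.
Qed.

End GeneralSmooth.

(** A nonzero coefficient of [X] is all that is required of a form in [V_d] to cut
out the given cones; it is nonzero if the form restricts to a cone on [T]. *)
Lemma suited_extension (T : triple F n d) :
    in_Pd T -> (forall i, ~~ (vertex T <= V i)%MS) ->
  suited (fun o : option 'I_e => if o is Some i then L i else T) <->
  Vd_restricted L (hplane T) (cone T).
Proof.
move=> TPd vT; have [_ _ _ [CT0 _ _]] := TPd; split.
  move=> [X' _ X'E]; have [_ [_ CX']] := X'E None.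
  have [a aE] : exists a, restriction (hplane T) X' = a *: mpoly_of_dhomog (cone T).
    apply: (zero_scheme_sub_scalar CT0 (dhomog_is_dhomog _) _ CX').
    exact/linear_subst_homog/dhomog_is_dhomog.
  have a0 : a != 0.
    by have [X'0 _] := X'E None; apply: contraNneq X'0 => a0; rewrite aE a0 scale0r.
  exists (a^-1 *: X').
    move=> i; have [_ [_ [h hE]]] := X'E (Some i); exists (a^-1 *: h).
    by rewrite [LHS]linear_substZ [linear_subst _ _]hE scalerAl.
  by rewrite [RHS]linear_substZ [linear_subst _ _]aE scalerA mulVf // scale1r.
move=> [s sV CE]; have [a [g sE]] := Vd_decomposition sV.
have a0 : a != 0.
  pose i0 := Ordinal e_gt0; have vc : vertex T *m c i0 != 0 by rewrite -cE.
  have [y yc] := cone_avoids_hyperplane TPd vc.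
  apply: contraNneq => a0; rewrite CE [_.@[_]]meval_linear_subst sE a0 scale0r add0r.
  rewrite mevalM [l.@[_]]rmorph_prod (bigD1 i0) //= meval_linear_form yc mxE.
  by rewrite !mul0r.
exists s.
  apply: contraNneq CT0 => s0; apply/eqP/val_inj => /=.
  by rewrite CE s0 [restriction _ _]comp_mpoly0.
case=> [i|].
  have -> : restriction (V i) s = (a * u i) *: C i.
    rewrite sE [LHS]linear_substD linear_substZ linear_substM [linear_subst _ X]XE.
    by rewrite [linear_subst _ l]restriction_product mul0r addr0 scalerA.
  split; first by rewrite scaler_eq0 negb_or mulf_neq0 // C0.
  by apply: scalar_zero_scheme_eq; rewrite mulf_neq0.
rewrite -CE; split=> //; rewrite -{1}[mpoly_of_dhomog (cone T)]scale1r.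
exact/scalar_zero_scheme_eq/oner_neq0.
Qed.

End Suited.

Lemma suited_scalars (F : closedFieldType) (n d e : nat) (L : 'I_e -> triple F n d) :
    (forall i, in_Pd (L i)) -> suited L ->
  exists (X : dhomog n.+2 F d) (u : 'I_e -> F), (forall i, u i != 0) /\
    (forall i, restriction (hplane (L i)) X = u i *: mpoly_of_dhomog (cone (L i))).
Proof.
move=> LPd [X _ XL]; exists X.
have /choice [u uE] i : exists u, restriction (hplane (L i)) X = u *: mpoly_of_dhomog (cone (L i)).
  have [_ _ _ [C0 _ _]] := LPd i.
  apply: (zero_scheme_sub_scalar C0 (dhomog_is_dhomog _) _ (XL i).2.2).
  exact/linear_subst_homog/dhomog_is_dhomog.
exists u; split=> // i; have [X0 _] := XL i.
by apply: contraNneq X0 => u0; rewrite uE u0 scale0r.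
Qed.

(** * The theorem *)

Unset Implicit Arguments.

(* The projective space is P^N with N = n.+1. *)
Theorem theorem2p10 (R : realType) (n d e : nat)
    (L : 'I_e -> triple (complex R) n d) :
  (3 <= d)%N -> (1 <= e)%N -> (2 <= n.+1)%N ->
  (forall i, in_Pd (L i)) ->
  (forall i j, i != j -> ~~ (vertex (L i) <= hplane (L j))%MS) ->
  suited L ->
  (* (i) *)
  (proj_dim (Vd L) (if (e <= d)%N then 'C(d - e + n.+1, n.+1) else 0%N) /\
   ((e <= d)%N ->
      general (Vd L) (fun X : dhomog n.+2 (complex R) d => smooth_hypersurface X))) /\
  (* (ii) *)
  (forall H : 'M[complex R]_(n.+1, n.+2),
     row_free H -> (forall i, ~~ (vertex (L i) <= H)%MS) ->
     ((e <= d)%N ->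
        proj_dim (fun f : dhomog n.+1 (complex R) d => Vd_restricted L H f)
          'C(d - e + n, n) /\
        (forall h : 'I_e -> dhomog n.+1 (complex R) 1,
           (forall i, section_equation H (hplane (L i)) (h i)) ->
           forall g : dhomog n.+1 (complex R) (d - e), g != 0 ->
             Vd_restricted L H
               ((\prod_(i < e) mpoly_of_dhomog (h i)) * mpoly_of_dhomog g))) /\
     ((d < e)%N ->
        proj_dim (fun f : dhomog n.+1 (complex R) d => Vd_restricted L H f) 0)) /\
  (* (iii) *)
  (forall T : triple (complex R) n d,
     in_Pd T ->
     (forall i, ~~ (vertex (L i) <= hplane T)%MS) ->
     (forall i, ~~ (vertex T <= hplane (L i))%MS) ->
     (suited (fun o : option 'I_e => if o is Some i then L i else T) <->
      Vd_restricted L (hplane T) (cone T))).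
Proof.
move=> _ e_gt0 _ LPd Lsep Lsuited.
have [X [u [u0 XE]]] := suited_scalars LPd Lsuited.
have /choice [c cE] i : exists c, equation (hplane (L i)) c.
  by apply: hyperplane_equation; case: (LPd i).
split; last split.
- split; first exact: (Vd_proj_dim e_gt0 LPd Lsep cE u0 XE).
  move=> led; apply: (general_smooth e_gt0 LPd Lsep cE u0 XE) => //.
  + exact: pchar_num.
  + exact: complex_avoids_roots.
- move=> H freeH vH; split; last first.
    exact: (restricted_proj_dim_gt e_gt0 LPd Lsep cE u0 XE freeH).
  move=> led; split.
    exact: (restricted_proj_dim_le e_gt0 LPd Lsep cE u0 XE freeH vH led).
  move=> h hE g _.
  exact: (restricted_contains e_gt0 LPd Lsep cE u0 XE freeH vH led g hE).
- move=> T TPd vT vT'.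
  exact: (suited_extension e_gt0 LPd Lsep cE u0 XE TPd vT').
Qed.
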